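(* Let $r$ and $n$ be coprime integers with $1\le r\le n-1$. Then the GIT quotient $T\backslash\!\backslash X(w_{r,n})^{ss}_T(\mathcal{L}(n\omega_r))$ is smooth.
   Context: $G=SL(n,\mathbb{C})$, $T$ is the subgroup of diagonal matrices, $B$ the subgroup of upper triangular matrices, $P=P_{\hat{\alpha_r}}$ the stabilizer of $\langle e_1,\dots,e_r\rangle$, and $G/P=G_{r,n}$ is the Grassmannian of $r$-dimensional subspaces of $\mathbb{C}^n$. Minimal-length coset representatives $w\in W^{S\setminus\{\alpha_r\}}$ of $W=S_n$ modulo $W_P$ are identified with increasing $r$-tuples $(w(1)<\dots<w(r))$ in $\{1,\dots,n\}$; the Bruhat order is $v\le w$ iff $v(i)\le w(i)$ for all $i$. The $T$-fixed points are $e_w=[e_{w(1)}\wedge\cdots\wedge e_{w(r)}]$, and the Schubert variety $X(w)$ is the closure of $Be_w$. $\mathcal{L}(\omega_r)$ is the pullback of $\mathcal{O}(1)$ under the Plücker embedding $G_{r,n}\hookrightarrow\mathbb{P}(\bigwedge^r\mathbb{C}^n)$ with its natural $T$-linearization, and $\mathcal{L}(n\omega_r)=\mathcal{L}(\omega_r)^{\otimes n}$. For a $T$-stable closed subvariety $X\subseteq G_{r,n}$ and a $T$-linearized ample line bundle $\mathcal L$, $X^{ss}_T(\mathcal{L})$ is the set of points $x\in X$ for which some $T$-invariant section over $X$ of a positive power of $\mathcal L$ does not vanish at $x$; the GIT quotient is $T\backslash\!\backslash X^{ss}_T(\mathcal{L})=\mathrm{Proj}\bigoplus_{m\ge0}H^0(X,\mathcal{L}^{\otimes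 m})^T$. $X(w_{r,n})$ denotes the unique minimal Schubert variety in $G_{r,n}$ admitting semistable points with respect to $\mathcal{L}(n\omega_r)$; explicitly $w_{r,n}=(a_1,\dots,a_r)$, where $a_i$ is the smallest integer with $a_i r\ge i n$. *)

(* Defs.v *)
From HB Require Import structures.
From mathcomp Require Import all_boot all_order all_algebra.
From mathcomp Require Import boolp classical_sets functions reals complex.
From mathcomp.multinomials Require Import mpoly.

Set Implicit Arguments.
Unset Strict Implicit.
Unset Printing Implicit Defensive.

Import GRing.Theory.
Local Open Scope ring_scope.

(* [A] is the [K]-algebra with structure map [iota]; rings may be zero. *)
Definition finitely_presented (K : fieldType) (A : comPzRingType)
    (iota : {rmorphism K -> A}) : Prop :=
  exists (k l : nat) (phi : {rmorphism {mpoly K[k]} -> A})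
         (g : 'I_l -> {mpoly K[k]}),
    [/\ forall c : K, phi c%:MP = iota c,
        forall a : A, exists p, phi p = a
      & forall p, phi p = 0 <->
          exists q : 'I_l -> {mpoly K[k]}, p = \sum_(j < l) q j * g j].

(* Infinitesimal lifting: [pi : B -> B'] is a surjection of [K]-algebras whose
   kernel has square zero, i.e. [B'] is [B / I] with [I ^ 2 = 0]. *)
Definition formally_smooth (K : fieldType) (A : comPzRingType)
    (iota : {rmorphism K -> A}) : Prop :=
  forall (B B' : comPzRingType) (jota : {rmorphism K -> B})
         (pi : {rmorphism B -> B'}),
    (forall b' : B', exists b, pi b = b') ->
    (forall x y : B, pi x = 0 -> pi y = 0 -> x * y = 0) ->
    forall u : {rmorphism A -> B'}, (forall c, u (iota c) = pi (jota c)) ->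
    exists v : {rmorphism A -> B},
      (forall c, v (iota c) = jota c) /\ (forall a, pi (v a) = u a).

(* [Spec A -> Spec K] is a smooth morphism in the sense of EGA IV, 17.3.1. *)
Definition smooth_algebra (K : fieldType) (A : comPzRingType)
    (iota : {rmorphism K -> A}) : Prop :=
  finitely_presented iota /\ formally_smooth iota.

(* A graded [K]-algebra [S = \bigoplus_m S_m] each of whose components is a
   space of [K]-valued functions on [D], with multiplication computed
   pointwise. *)
Record gradedFunAlg (K : fieldType) (D : Type) := GradedFunAlg {
  gpart :> nat -> set (D -> K);
  gpart_cst : forall c : K, gpart 0 (cst c);
  gpart_sub : forall m f g, gpart m f -> gpart m g -> gpart m (f - g);
  gpart_mul : forall m k f g, gpart m f -> gpart k g -> gpart (m + k)%N (f * g)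
}.

Section Proj.
Variables (K : fieldType) (D : Type) (S : gradedFunAlg K D).

(* The homogeneous localization [S_(f)], for [f] in [S_m]: its elements are
   the fractions [s / f ^ k] with [s] in [S_(k m)].  As the [S_i] consist of
   functions with values in a field, such a fraction is zero in [S_(f)] iff it
   vanishes at all points where [f] does not, so [S_(f)] is a ring of functions
   on the nonvanishing locus of [f]. *)
Definition nonvanishing (f : D -> K) := {x : D | f x != 0}.

Definition is_fraction (m : nat) (f : D -> K) (h : nonvanishing f -> K) :=
  exists k s, S (k * m)%N s /\ forall x, h x = s (val x) / f (val x) ^+ k.

Definition homog_loc_pred (m : nat) (f : D -> K) (fP : S m f) :
  {pred nonvanishing f -> K} := [pred h | `[< is_fraction m h >]].

Lemma gpart_exp (m k : nat) (f : D -> K) : S m f -> S (k * m)%N (f ^+ k).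
Proof.
move=> Sf; elim: k => [|k IH]; first by rewrite expr0; apply: gpart_cst.
by rewrite mulSn exprS; apply: gpart_mul.
Qed.

Section HomogLoc.
Variables (m : nat) (f : D -> K) (fP : S m f).

Fact homog_loc_subring : subring_closed (homog_loc_pred fP).
Proof.
split=> [|h h' /asboolP[k [s [Ss hE]]] /asboolP[k' [s' [Ss' hE']]]
         |h h' /asboolP[k [s [Ss hE]]] /asboolP[k' [s' [Ss' hE']]]].
- apply/asboolP; exists 0%N, (cst 1); split; first exact: gpart_cst.
  by move=> x; rewrite expr0 divr1.
- apply/asboolP; exists (k + k')%N, (s * f ^+ k' - s' * f ^+ k); split.
    rewrite mulnDl; apply: gpart_sub; first exact: gpart_mul (gpart_exp _ _).
    by rewrite addnC; apply: gpart_mul (gpart_exp _ _).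
  move=> x; have nz := valP x; rewrite /= in nz.
  have -> : (h - h') x = h x - h' x by [].
  have -> : (s * f ^+ k' - s' * f ^+ k) (val x) =
    s (val x) * (f ^+ k') (val x) - s' (val x) * (f ^+ k) (val x) by [].
  by rewrite hE hE' !exprfctE -mulNr addf_div ?expf_neq0 // mulNr exprD.
- apply/asboolP; exists (k + k')%N, (s * s'); split.
    by rewrite mulnDl; apply: gpart_mul.
  move=> x; have -> : (h * h') x = h x * h' x by [].
  by rewrite hE hE' mulf_div exprD.
Qed.

Record homog_loc :=
  HomogLoc { homog_loc_val :> nonvanishing f -> K;
             homog_loc_valP : homog_loc_val \in homog_loc_pred fP }.

HB.instance Definition _ := [isSub for homog_loc_val].
HB.instance Definition _ := [Choice of homog_loc by <:].
HB.instance Definition _ :=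
  GRing.SubChoice_isSubComPzRing.Build _ _ homog_loc homog_loc_subring.

Fact homog_loc_cstP (c : K) : cst c \in homog_loc_pred fP.
Proof.
apply/asboolP; exists 0%N, (cst c); split; first exact: gpart_cst.
by move=> x; rewrite expr0 divr1.
Qed.

Definition homog_loc_cst (c : K) : homog_loc := HomogLoc (homog_loc_cstP c).

Fact homog_loc_cst_zmod : zmod_morphism homog_loc_cst.
Proof. by move=> c d; apply: val_inj. Qed.

Fact homog_loc_cst_monoid : monoid_morphism homog_loc_cst.
Proof. by split=> [|c d]; apply: val_inj. Qed.

HB.instance Definition _ :=
  GRing.isZmodMorphism.Build K homog_loc homog_loc_cst homog_loc_cst_zmod.
HB.instance Definition _ :=
  GRing.isMonoidMorphism.Build K homog_loc homog_loc_cst homog_loc_cst_monoid.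

End HomogLoc.

(* The points of [Proj S]: homogeneous prime ideals not containing the
   irrelevant ideal [S_+].  A homogeneous ideal [p] is given by its components
   [p m], and it is prime iff it is so on homogeneous elements. *)
Definition proj_point (p : nat -> set (D -> K)) : Prop :=
  [/\ forall m f, p m f -> S m f,
      forall m, p m 0 /\ forall f g, p m f -> p m g -> p m (f + g),
      forall m k f g, S m f -> p k g -> p (m + k)%N (f * g),
      forall m k f g, S m f -> S k g -> p (m + k)%N (f * g) -> p m f \/ p k g
    & exists m f, [/\ (0 < m)%N, S m f & ~ p m f] ].

(* [Proj S] is smooth over [K]: every point lies in a standard affine open
   subset [D_+(f) = Spec S_(f)] with [S_(f)] smooth over [K]. *)
Definition Proj_smooth : Prop :=
  forall p, proj_point p ->
    exists (m : nat) (f : D -> K) (fP : S m f),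
      [/\ (0 < m)%N, ~ p m f & smooth_algebra (homog_loc_cst fP) ].

End Proj.

Section Schubert.
Variables (K : fieldType) (r n : nat).

Definition inc_tuple := {w : {ffun 'I_r -> 'I_n} |
  [forall i : 'I_r, forall j : 'I_r, (i < j)%N ==> (w i < w j)%N]}.

(* The exterior power [\bigwedge^r K^n], in Pluecker coordinates. *)
Definition extpow := {ffun inc_tuple -> K}.

(* [e_w = e_(w 1) /\ ... /\ e_(w r)] *)
Definition ebasis (w : inc_tuple) : extpow := [ffun v => (v == w)%:R].

(* The action of [g] on the exterior power: the coefficient of [e_u] in
   [g e_(v 1) /\ ... /\ g e_(v r)] is the minor of [g] with rows [u] and
   columns [v]. *)
Definition ext_act (g : 'M[K]_n) (x : extpow) : extpow :=
  [ffun u : inc_tuple => \sum_(v : inc_tuple)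
     \det (\matrix_(i < r, j < r) g (val u i) (val v j)) * x v].

Definition torus (g : 'M[K]_n) : Prop := is_diag_mx g /\ \det g = 1.

Definition borel (g : 'M[K]_n) : Prop :=
  (forall i j : 'I_n, (j < i)%N -> g i j = 0) /\ \det g = 1.

(* Nonzero decomposable vectors (the wedge of the columns of [A]): the
   punctured affine cone over the image of the Pluecker embedding. *)
Definition grass_cone : set extpow :=
  [set x | exists A : 'M[K]_(n, r), \rank A = r /\
     x = [ffun u : inc_tuple => \det (\matrix_(i < r, j < r) A (val u i) j)]].

Definition ext_eval (P : {mpoly K[#|{: inc_tuple}|]}) (x : extpow) : K :=
  P.@[fun i => x (enum_val i)].

(* The punctured affine cone over [X(w)], the Zariski closure of the orbit
   [B e_w] in the Grassmannian. *)
Definition schubert_cone (w : inc_tuple) : set extpow :=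
  [set x | grass_cone x /\
     forall (d : nat) (P : {mpoly K[#|{: inc_tuple}|]}), P \is d.-homog ->
       (forall b, borel b -> ext_eval P (ext_act b (ebasis w)) = 0) ->
       ext_eval P x = 0].

Section Sections.
Variable X : set extpow.

(* Sections over [X] of the [k]-th power of [O(1)]: functions on the punctured
   cone that are locally quotients [G / H] of homogeneous polynomials with
   [deg G = deg H + k]. *)
Definition section_space (k : nat) : set ({x | X x} -> K) :=
  [set F | forall x : {x | X x}, exists d (G H : {mpoly K[#|{: inc_tuple}|]}),
     [/\ G \is (d + k).-homog, H \is d.-homog, ext_eval H (sval x) != 0
       & forall y : {x | X x}, ext_eval H (sval y) != 0 ->
           F y = ext_eval G (sval y) / ext_eval H (sval y)] ].

Definition torus_invariant (F : {x | X x} -> K) : Prop :=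
  forall t, torus t ->
  forall x y : {x | X x}, sval y = ext_act t (sval x) -> F y = F x.

(* [H^0(X, L^m)^T], where [L = L(n omega_r)] is the [n]-th power of [O(1)]. *)
Definition inv_sections (m : nat) : set ({x | X x} -> K) :=
  [set F | section_space (n * m) F /\ torus_invariant F].

Fact inv_sections_cst (c : K) : inv_sections 0 (cst c).
Proof.
split=> // x; exists 0%N, c%:MP, 1.
have ev1 y : ext_eval 1 y = 1 by rewrite /ext_eval meval1.
split=> [||| y _]; rewrite ?ev1 ?oner_eq0 ?muln0 ?dhomog1 //.
  by rewrite addn0 -[c%:MP]mulr1 mul_mpolyC; apply/dhomogZ/dhomog1.
by rewrite /ext_eval mevalC divr1.
Qed.

Fact inv_sections_sub m F G :
  inv_sections m F -> inv_sections m G -> inv_sections m (F - G).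
Proof.
move=> [sF iF] [sG iG]; split=> [x|t tT x y xy]; last first.
  by congr (_ - _); [apply: iF xy | apply: iG xy].
have [d [A [B [hA hB Bx FE]]]] := sF x.
have [d' [A' [B' [hA' hB' Bx' GE]]]] := sG x.
exists (d + d')%N, (A * B' - A' * B), (B * B').
have evM P Q y : ext_eval (P * Q) y = ext_eval P y * ext_eval Q y.
  by rewrite /ext_eval mevalM.
have evB P Q y : ext_eval (P - Q) y = ext_eval P y - ext_eval Q y.
  by rewrite /ext_eval mevalB.
split; [|exact: dhomogM | by rewrite evM mulf_neq0 | move=> y].
  apply: rpredB; first by rewrite addnAC dhomogM.
  by rewrite -addnA addnC dhomogM.
rewrite evM mulf_eq0 negb_or => /andP[By By'].
have -> : (F - G) y = F y - G y by [].
by rewrite FE // GE // evB !evM -mulNr addf_div // mulNr.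
Qed.

Fact inv_sections_mul m k F G :
  inv_sections m F -> inv_sections k G -> inv_sections (m + k)%N (F * G).
Proof.
move=> [sF iF] [sG iG]; split=> [x|t tT x y xy]; last first.
  by congr (_ * _); [apply: iF xy | apply: iG xy].
have [d [A [B [hA hB Bx FE]]]] := sF x.
have [d' [A' [B' [hA' hB' Bx' GE]]]] := sG x.
exists (d + d')%N, (A * A'), (B * B').
have evM P Q y : ext_eval (P * Q) y = ext_eval P y * ext_eval Q y.
  by rewrite /ext_eval mevalM.
split; [by rewrite mulnDr addnACA dhomogM | exact: dhomogM
       | by rewrite evM mulf_neq0 | move=> y].
rewrite evM mulf_eq0 negb_or => /andP[By By'].
have -> : (F * G) y = F y * G y by [].
by rewrite FE // GE // !evM mulf_div.
Qed.

Definition inv_section_ring : gradedFunAlg K {x | X x} :=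
  GradedFunAlg inv_sections_cst inv_sections_sub inv_sections_mul.

(* Smoothness of the GIT quotient of [X] by [T] with respect to
   [L(n omega_r)], that is of the Proj of the ring of invariant sections. *)
Definition GIT_quotient_smooth : Prop := Proj_smooth inv_section_ring.

End Sections.
End Schubert.

Fact w_min_ex (r n i : nat) (r_gt0 : (0 < r)%N) :
  exists a : nat, (i * n <= a * r)%N.
Proof. by exists (i * n)%N; rewrite leq_pmulr. Qed.

(* [a_i], the smallest [a] with [a r >= i n]; [i] ranges over [1, ..., r]. *)
Definition w_min (r n : nat) (r_gt0 : (0 < r)%N) (i : nat) : nat :=
  ex_minn (w_min_ex n i r_gt0).

Section MinimalTuple.
Variables (r n : nat) (r_gt0 : (0 < r)%N) (r_lt_n : (r < n)%N).

Fact w_min_gt0 (i : nat) : (0 < w_min n r_gt0 i.+1)%N.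
Proof.
rewrite /w_min; case: ex_minnP => [[|a]] // + _.
by rewrite mul0n leqn0 muln_eq0 /= -leqn0 leqNgt (leq_ltn_trans _ r_lt_n).
Qed.

Fact w_min_le (i : nat) : (i <= r)%N -> (w_min n r_gt0 i <= n)%N.
Proof.
move=> ir; rewrite /w_min; case: ex_minnP => a _; apply.
by rewrite mulnC leq_mul2l ir orbT.
Qed.

Fact w_min_lt (i j : nat) :
  (i < j)%N -> (w_min n r_gt0 i.+1 < w_min n r_gt0 j.+1)%N.
Proof.
move=> ij; rewrite -(ltn_predK (w_min_gt0 j)) ltnS.
rewrite {1}/w_min; case: ex_minnP => a _; apply.
rewrite /w_min; case: ex_minnP => [[|b]] /= bP _.
  move: bP; rewrite mul0n leqn0 muln_eq0 /= -leqn0 leqNgt.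
  by rewrite (leq_ltn_trans _ r_lt_n).
rewrite -(leq_add2l r) -mulSn (leq_trans _ bP) //.
apply: leq_trans (_ : i.+2 * n <= _)%N; last by rewrite leq_mul2r ltnS ij orbT.
by rewrite [(i.+2 * n)%N]mulSn leq_add2r ltnW.
Qed.

Fact w_min_ord (i : 'I_r) : ((w_min n r_gt0 i.+1).-1 < n)%N.
Proof. by rewrite (ltn_predK (w_min_gt0 i)) w_min_le. Qed.

(* Indices and values are shifted by one: ['I_n] starts at [0]. *)
Definition w_rn_fun : {ffun 'I_r -> 'I_n} :=
  [ffun i : 'I_r => Ordinal (w_min_ord i)].

Fact w_rn_inc : [forall i : 'I_r, forall j : 'I_r,
  (i < j)%N ==> (w_rn_fun i < w_rn_fun j)%N].
Proof.
apply/forallP => i; apply/forallP => j; apply/implyP => ij.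
by rewrite !ffunE /= -ltnS !(ltn_predK (w_min_gt0 _)) w_min_lt.
Qed.

Definition w_rn : inc_tuple r n := exist _ w_rn_fun w_rn_inc.

End MinimalTuple.

(* Main.v *)
Require Import Defs.
From mathcomp Require Import all_boot all_order all_algebra.
From mathcomp Require Import reals complex.
From HB Require Import structures.
From mathcomp Require Import fingroup perm.
From mathcomp Require Import boolp classical_sets functions ring.
From mathcomp.multinomials Require Import mpoly.

(** The open cell of [X(w)] consists of the column spaces of the echelon matrices
    with pivot rows [w].  Its coordinates are the edges [(i, j)], with [i] a
    nonpivot row above the pivot [w j], of a bipartite graph between the [n - r]
    nonpivot rows and the [r] columns, and the torus [T] acts on the coordinate
    [(i, j)] by the character [t_i / t_(w j)].  The quotient turns out to be the
    toric variety of a transportation polytope of this graph, and it is smooth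
    because incidence matrices of bipartite graphs are unimodular and because
    coprimality makes the polytope generic.

    Restriction to the cell is injective on sections of the powers of the line
    bundle, since the Borel orbit is dense ([section_cell_inj]).  A regular function
    on the cell, an affine space, is a polynomial ([regular_polynomial]).  If it
    comes from a [T]-invariant section of degree [m], its monomials have the weight
    that makes their exponent a transport: all row sums are [r m] and all column
    sums are [(n - r) m] ([inv_section_transport]).  Conversely the monomial of a
    transport extends to an invariant section ([cell_monomial_extends]).  To see
    this, view the edge [(i, j)] as the interval [[i, w j]].  A product of
    coordinates over pairwise disjoint intervals is a maximal minor, hence a
    Pluecker coordinate up to sign ([det_exchange]).  The inequalities
    [r * w j <= (j + 1) * n], with indices counted from [0], bound by [n m] the
    number of edges of a transport whose intervals share a point, so that the edges
    can be coloured with [n m] colours, disjointly within each colour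
    ([interval_coloring]): the monomial is a product of [n m] Pluecker coordinates.

    So the ring of invariant sections is the semigroup algebra of the transports,
    and smoothness of its Proj is combinatorial ([toric_Proj_smooth]).  A
    homogeneous prime that does not contain the irrelevant ideal omits the monomial
    of some transport [d]; subtracting circulations shrinks the support of [d] until
    it is a forest ([acyclic_transport]).  A connected component with [a] rows and
    [b] columns satisfies [a r = b (n - r)], so for coprime [r] and [n] the support
    is a spanning tree ([transport_connected]).  On the chart where the monomial of
    a spanning tree does not vanish, the degree [0] functions are polynomials in the
    fundamental cycles of the edges off the tree, which are algebraically
    independent ([tree_chart_smooth]): the chart is an affine space. *)

Set Implicit Arguments.
Unset Strict Implicit.
Unset Printing Implicit Defensive.

Import Order.TTheory GRing.Theory Num.Theory.
Local Open Scope ring_scope.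

(** * Polynomial rings *)

Lemma base_expansion_inj (B n : nat) (a b : 'I_n -> nat) :
  (forall i, a i < B)%N -> (forall i, b i < B)%N ->
  (\sum_(i < n) a i * B ^ i = \sum_(i < n) b i * B ^ i)%N -> a =1 b.
Proof.
elim: n a b => [|n IH] a b aB bB; first by move=> _ [].
rewrite !big_ord_recl expn0 !muln1.
pose T (c : 'I_n.+1 -> nat) := (\sum_(i < n) c (lift ord0 i) * B ^ i)%N.
have shiftE c : (\sum_(i < n) c (lift ord0 i) * B ^ (bump 0 i) = T c * B)%N.
  by rewrite big_distrl; apply: eq_bigr => i _; rewrite /= expnSr mulnA.
rewrite !shiftE => eq_ab.
have eq0 : a ord0 = b ord0.
  by have := congr1 (modn^~ B) eq_ab; rewrite ![(_ + _ * B)%N]addnC !modnMDl !modn_small.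
have B_gt0 : (0 < B)%N by apply: leq_trans (aB ord0).
have eqT : T a = T b.
  by move/eqP: eq_ab; rewrite eq0 eqn_add2l eqn_pmul2r // => /eqP.
move=> i; case: (unliftP ord0 i) => [j ->|->] //.
exact: (IH (fun j => a (lift ord0 j)) (fun j => b (lift ord0 j))).
Qed.

Lemma poly_eval_eq0 (K : numFieldType) (p : {poly K}) :
  (forall t, p.[t] = 0) -> p = 0.
Proof.
move=> p0; apply: (@roots_geq_poly_eq0 _ _ [seq i%:R | i <- iota 0 (size p)]).
- by apply/allP => t _; apply/rootP.
- by rewrite map_inj_uniq ?iota_uniq // => i j /eqP; rewrite eqr_nat => /eqP.
- by rewrite size_map size_iota.
Qed.

(** Kronecker substitution: the monomials of [p] stay distinct when the [i]-th
    variable is replaced by the [B ^ i]-th power of one variable, [B] exceeding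
    all exponents. *)
Lemma mpoly_eval_eq0 (K : numFieldType) (n : nat) (p : {mpoly K[n]}) :
  (forall v, p.@[v] = 0) -> p = 0.
Proof.
move=> p0; pose B := msize p.
pose e (m : 'X_{1..n}) := (\sum_(i < n) m i * B ^ i)%N.
pose q : {poly K} := \sum_(m <- msupp p) p@_m *: 'X^(e m).
have q0 : q = 0.
  apply: poly_eval_eq0 => t; rewrite -[RHS](p0 (fun i => t ^+ (B ^ i))).
  rewrite mevalE horner_sum; apply: eq_bigr => m _.
  rewrite hornerZ hornerXn /e -prodrXr; congr (_ * _); apply: eq_bigr => i _.
  by rewrite mulnC exprM.
have ltB m i : m \in msupp p -> (m i < B)%N.
  move=> mp; apply: leq_ltn_trans (msize_mdeg_lt mp).
  by rewrite mdegE (bigD1 i) //= leq_addr.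
apply/mpolyP => m; rewrite mcoeff0.
have [mp|] := boolP (m \in msupp p); last by move/memN_msupp_eq0.
have := congr1 (fun u : {poly K} => u`_(e m)) q0.
rewrite coef0 coef_sum (bigD1_seq m) ?msupp_uniq //= coefZ coefXn eqxx mulr1.
rewrite big_seq_cond big1 ?addr0 // => m' /andP[m'p m'm].
rewrite coefZ coefXn; case: eqP => [ee|_]; last by rewrite mulr0.
by case/eqP: m'm; apply/mnmP => i;
  apply: (base_expansion_inj _ _ (esym ee)) => j; apply: ltB.
Qed.

(** [mmap] needs a nontrivial target; over the zero ring evaluation is the zero
    map. *)
Lemma mpoly_eval_pz (K : fieldType) (n : nat) (B : comPzRingType)
    (jota : {rmorphism K -> B}) (b : 'I_n -> B) :
  exists v : {rmorphism {mpoly K[n]} -> B},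
    (forall c, v c%:MP = jota c) /\ (forall i, v 'X_i = b i).
Proof.
have [B0|B1] := eqVneq (1 : B) 0.
  have all0 (x : B) : x = 0 by rewrite -[x]mulr1 B0 mulr0.
  pose v (p : {mpoly K[n]}) : B := 0.
  have vz : zmod_morphism v by move=> p q; rewrite /v subr0.
  have vm : monoid_morphism v by split=> [|p q]; rewrite /v ?mulr0 ?B0.
  pose V : {rmorphism {mpoly K[n]} -> B} :=
    HB.pack v (GRing.isZmodMorphism.Build _ _ v vz)
              (GRing.isMonoidMorphism.Build _ _ v vm).
  by exists V; split=> *; rewrite [LHS]all0 [RHS]all0.
pose B' : comNzRingType := HB.pack (B : Type) B (GRing.PzSemiRing_isNonZero.Build B B1).
pose j' : {rmorphism K -> B'} := jota.
pose v : {rmorphism {mpoly K[n]} -> B'} := mmap j' (b : 'I_n -> B').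
exists v; split => [c|i].
  exact: (mmapC (b : 'I_n -> B') j' c).
by rewrite /v /=; rewrite mmapX mmap1U.
Qed.

Lemma rmorph_mpoly_ext (K : fieldType) (n : nat) (B : comPzRingType)
    (u v : {rmorphism {mpoly K[n]} -> B}) :
  (forall c, u c%:MP = v c%:MP) -> (forall i, u 'X_i = v 'X_i) -> u =1 v.
Proof.
move=> uvC uvX p; rewrite [p]mpolyE !rmorph_sum; apply: eq_bigr => m _ /=.
rewrite -mul_mpolyC !rmorphM uvC; congr (_ * _).
rewrite mpolyXE_id !rmorph_prod; apply: eq_bigr => i _ /=.
by rewrite !rmorphXn uvX.
Qed.

(** Polynomial rings are smooth: there are no relations, and a map out of them
    is lifted by lifting the images of the variables. *)
Lemma smooth_polynomial (K : fieldType) (A : comPzRingType)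
    (iota : {rmorphism K -> A}) (n : nat) (phi : {rmorphism {mpoly K[n]} -> A}) :
  (forall c, phi c%:MP = iota c) -> injective phi ->
  (forall a, exists p, phi p = a) -> smooth_algebra iota.
Proof.
move=> phiC phi_inj phi_surj; split.
  exists n, 0%N, phi, (fun=> 0); split=> // p; split=> [p0|[q ->]].
    by exists (fun=> 0); rewrite big_ord0; apply: phi_inj; rewrite p0 rmorph0.
  by rewrite big_ord0 rmorph0.
move=> B B' jota pi pi_surj _ u uiota.
have [psi psiK] := choice phi_surj.
have [b bE] := choice (fun i : 'I_n => pi_surj (u (phi 'X_i))).
have [v [vC vX]] := mpoly_eval_pz jota b.
have psiz : zmod_morphism (v \o psi).
  move=> x y /=; rewrite -rmorphB; congr (v _); apply: phi_inj.
  by rewrite rmorphB !psiK.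
have psim : monoid_morphism (v \o psi).
  split=> [|x y] /=; rewrite -?rmorphM -?(rmorph1 v); congr (v _); apply: phi_inj.
    by rewrite rmorph1 psiK.
  by rewrite rmorphM !psiK.
pose w : {rmorphism A -> B} :=
  HB.pack (v \o psi) (GRing.isZmodMorphism.Build _ _ _ psiz)
                     (GRing.isMonoidMorphism.Build _ _ _ psim).
exists w; split=> [c|a]; rewrite /w /=.
  rewrite -vC; congr (v _); apply: phi_inj; by rewrite psiK phiC.
rewrite -[in RHS](psiK a).
have := @rmorph_mpoly_ext K n B' (pi \o v) (u \o phi); apply=> [c|i] /=.
  by rewrite vC phiC uiota.
by rewrite vX.
Qed.

(** * Regular functions on affine space *)

Section RegularFunctions.
Variable K : numClosedFieldType.

(** In lowest terms, a denominator of [g] has no root: at a root, comparison with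
    a local expression there would make the numerator vanish as well. *)
Lemma regular_polynomial1 (g : K -> K) :
  (forall a, exists G H : {poly K}, H.[a] != 0 /\
     forall t, H.[t] != 0 -> g t = G.[t] / H.[t]) ->
  exists p : {poly K}, forall t, g t = p.[t].
Proof.
move=> reg; have [G [H [H0 gE]]] := reg 0.
have Hn0 : H != 0 by apply: contraNneq H0 => ->; rewrite horner0.
pose q := gcdp G H.
have qn0 : q != 0 by rewrite gcdp_eq0 negb_and Hn0 orbT.
pose G' := G %/ q; pose H' := H %/ q.
have GE : G = G' * q by rewrite divpK ?dvdp_gcdl.
have HE : H = H' * q by rewrite divpK ?dvdp_gcdr.
have cop : coprimep G' H' by apply: coprimep_div_gcd; rewrite Hn0 orbT.
have cross a Ga Ha : Ha.[a] != 0 ->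
    (forall t, Ha.[t] != 0 -> g t = Ga.[t] / Ha.[t]) -> G' * Ha = Ga * H'.
  move=> Haa gaE.
  have Han0 : Ha != 0 by apply: contraNneq Haa => ->; rewrite horner0.
  suff /eqP : (G * Ha - Ga * H) * (H * Ha) = 0.
    rewrite !mulf_eq0 (negbTE Hn0) (negbTE Han0) !orbF subr_eq0 GE HE.
    by rewrite mulrAC mulrA (inj_eq (mulIf qn0)) => /eqP.
  apply: poly_eval_eq0 => t; rewrite hornerM hornerD hornerN !hornerM.
  have [->|Ht] := eqVneq H.[t] 0; first by rewrite !(mul0r, mulr0).
  have [->|Hat] := eqVneq Ha.[t] 0; first by rewrite !mulr0.
  have := gE t Ht; rewrite gaE // => /eqP; rewrite eqr_div // => /eqP <-.
  by rewrite subrr mul0r.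
have H'1 : size H' = 1%N.
  apply/eqP; apply: contraT => /closed_rootP[a aH'].
  have [Ga [Ha [Haa gaE]]] := reg a.
  have := congr1 (horner^~ a) (cross a Ga Ha Haa gaE).
  rewrite !hornerM (rootP aH') mulr0 => /eqP; rewrite mulf_eq0 (negbTE Haa) orbF.
  move=> G'a; move: cop; rewrite coprimep_sym => cop.
  by have := coprimep_root cop aH'; rewrite G'a.
have [c cn0 H'E] : exists2 c, c != 0 & H' = c%:P.
  by apply/size_poly1P; rewrite H'1.
exists (c^-1 *: G') => a; have [Ga [Ha [Haa gaE]]] := reg a.
have := congr1 (horner^~ a) (cross a Ga Ha Haa gaE).
rewrite !hornerM H'E hornerC => E.
by rewrite gaE // hornerZ; apply: (mulIf Haa); rewrite divfK // -mulrA E mulrC mulfK.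
Qed.

Variable N : nat.
Implicit Types (p : {mpoly K[N]}) (v : 'I_N -> K).

(** The restriction of [p] to the line through [0] and [v]. *)
Definition line_restr v : {mpoly K[N]} -> {poly K} :=
  mmap polyC (fun i => v i *: 'X).

HB.instance Definition _ v := GRing.RMorphism.on (line_restr v).

Lemma line_restrE v p :
  line_restr v p = \sum_(m <- msupp p) (p@_m * \prod_i v i ^+ m i) *: 'X^(mdeg m).
Proof.
apply: eq_bigr => m _; rewrite /= -mul_polyC polyCM -mulrA; congr (_ * _).
rewrite mul_polyC /mmap1 (eq_bigr (fun i => (v i ^+ m i) *: 'X^(m i))).
  by rewrite scaler_prod mdegE expr_sum.
by move=> i _; rewrite exprZn.
Qed.

Lemma line_restr_eval v p t : (line_restr v p).[t] = p.@[fun i => t * v i].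
Proof.
rewrite line_restrE horner_sum mevalE; apply: eq_bigr => m _.
rewrite hornerZ hornerXn -mulrA; congr (_ * _).
rewrite mdegE -prodrXr -big_split /=; apply: eq_bigr => i _.
by rewrite exprMn mulrC.
Qed.

Lemma coef_line_restr v p k : (line_restr v p)`_k = (pihomog mdeg k p).@[v].
Proof.
rewrite line_restrE coef_sum pihomogE raddf_sum /= [RHS]big_mkcond /=.
apply: eq_bigr => m _; rewrite coefZ coefXn eq_sym.
by case: eqP => _; rewrite ?mulr0 // mulr1 mevalZ mevalX.
Qed.

(** A regular function on affine space is a polynomial.  Write it near [0] as
    [G / (1 - h)] with [h] vanishing at [0].  On every line through [0] it is a
    polynomial of degree at most that of [G], by the case of one variable, so it
    is the truncation at that degree of the power series [G * \sum_k h ^ k]. *)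
Lemma regular_polynomial (g : ('I_N -> K) -> K) :
  (forall a, exists G H : {mpoly K[N]}, H.@[a] != 0 /\
     forall y, H.@[y] != 0 -> g y = G.@[y] / H.@[y]) ->
  exists p : {mpoly K[N]}, forall y, g y = p.@[y].
Proof.
move=> reg; have [G0 [H0 [H00 gE0]]] := reg (fun=> 0).
pose c := H0.@[fun=> 0]; pose G := c^-1 *: G0; pose h := 1 - c^-1 *: H0.
have gE y : (1 - h).@[y] != 0 -> g y = G.@[y] / (1 - h).@[y].
  rewrite /h subKr /G !mevalZ mulf_eq0 invr_eq0 (negbTE H00) => /= H0y.
  by rewrite gE0 // -mulf_div divff ?mul1r // invr_eq0.
have h0 : h.@[fun=> 0] = 0 by rewrite /h mevalB meval1 mevalZ mulVf ?subrr.
pose D := msize G; pose Q := G * \sum_(k < D) h ^+ k.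
exists (\sum_(k < D) pihomog mdeg k Q) => v.
pose l := line_restr v; pose u := l (1 - h).
have u0 : u.[0] != 0.
  rewrite /u /l line_restr_eval (meval_eq (v2 := fun=> 0)) => [|i].
    by rewrite mevalB meval1 h0 subr0 oner_eq0.
  by rewrite mul0r.
have un0 : u != 0 by apply: contraNneq u0 => ->; rewrite horner0.
have [gv gvE] : exists p : {poly K}, forall t, g (fun i => t * v i) = p.[t].
  apply: regular_polynomial1 => a.
  have [A [B [Ba gAB]]] := reg (fun i => a * v i).
  exists (l A), (l B); rewrite /l line_restr_eval; split=> // t.
  by rewrite !line_restr_eval => Bt; rewrite gAB.
have gvu : gv * u = l G.
  apply/eqP; rewrite -subr_eq0 -(inj_eq (mulIf un0)) mul0r; apply/eqP.
  apply: poly_eval_eq0 => t; rewrite hornerM hornerD hornerN hornerM -gvE.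
  have [->|ut] := eqVneq u.[t] 0; first by rewrite mulr0.
  have := ut; rewrite {1}/u /l line_restr_eval => /gE ->.
  by rewrite /u /l !line_restr_eval divfK ?subrr ?mul0r // -line_restr_eval.
have size_gv : (size gv <= D)%N.
  have [->|gvn0] := eqVneq gv 0; first by rewrite size_poly0.
  apply: leq_trans (_ : (size (l G) <= _)%N); last first.
    rewrite /l line_restrE; apply: leq_trans (size_sum _ _ _) _.
    apply/bigmax_leqP_seq => m mG _.
    by apply: leq_trans (size_scale_leq _ _) _; rewrite size_polyXn msize_mdeg_lt.
  rewrite -gvu size_mul // -[leqLHS]addn0 -subn1 -addnBA ?leq_add2l //.
  by rewrite lt0n size_poly_eq0.
have dvd : 'X^D %| l Q - gv.
  have cop : coprimep 'X^D u.
    apply: coprimep_expl; have := coprimep_XsubC u 0.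
    by rewrite polyC0 subr0 coprimep_sym => ->; rewrite rootE.
  rewrite -(Gauss_dvdpr _ cop) mulrBr [u * gv]mulrC gvu.
  rewrite /u -rmorphM /Q mulrCA.
  have -> : (1 - h) * (\sum_(k < D) h ^+ k) = 1 - h ^+ D.
    by rewrite -[LHS]opprK -mulNr opprB -subrX1 opprB.
  rewrite -rmorphB mulrBr mulr1 addrAC subrr add0r rmorphN rmorphM rmorphXn /=.
  rewrite dvdpNr dvdp_mull // dvdp_exp2r //.
  rewrite -['X]subr0 -polyC0 dvdp_XsubCl; apply/rootP.
  by rewrite line_restr_eval -[RHS]h0; apply: meval_eq => i; rewrite mul0r.
have coefE k : (k < D)%N -> gv`_k = (l Q)`_k.
  move=> kD; case/dvdpP: dvd => w wE.
  have := congr1 (fun p : {poly K} => p`_k) wE.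
  by rewrite coefB coefMXn kD => /eqP; rewrite subr_eq0 => /eqP.
rewrite (_ : g v = g (fun i => 1 * v i)); last first.
  by congr g; apply/funext => i; rewrite mul1r.
rewrite gvE (horner_coef_wide _ size_gv) raddf_sum /=; apply: eq_bigr => k _.
by rewrite -coef_line_restr expr1n mulr1 coefE.
Qed.
End RegularFunctions.

(** * Transports on a bipartite graph *)

Section Transportation.
Variables (N : nat) (V1 V2 : finType) (row : 'I_N -> V1) (col : 'I_N -> V2).
Implicit Types (m : nat) (d c : 'X_{1..N}) (z : 'I_N -> int).

(** Lattice points of the [m]-th multiple of the transportation polytope in which
    every row supplies [#|V2|] and every column demands [#|V1|]; both sides then
    have the same total. *)
Definition transport m d : Prop :=
  (forall i, \sum_(k < N | row k == i) d k = #|V2| * m)%N /\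
  (forall j, \sum_(k < N | col k == j) d k = #|V1| * m)%N.

(** The boundary of a 1-chain on the bipartite graph, its edges being directed
    from [V1] to [V2]. *)
Definition boundary z (w : V1 + V2) : int :=
  match w with
  | inl i => \sum_(k < N | row k == i) z k
  | inr j => - \sum_(k < N | col k == j) z k
  end.

(** The support of [d] is a forest: it carries no circulation. *)
Definition acyclic d : Prop :=
  forall z, (forall k, d k = 0%N -> z k = 0) ->
    (forall w, boundary z w = 0) -> forall k, z k = 0.

Lemma boundaryD z z' w :
  boundary (fun k => z k + z' k) w = boundary z w + boundary z' w.
Proof. by case: w => v /=; rewrite big_split //= opprD. Qed.

Lemma boundaryZ a z w : boundary (fun k => a * z k) w = a * boundary z w.
Proof. by case: w => v /=; rewrite -mulr_sumr ?mulrN. Qed.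

Lemma boundaryN z w : boundary (fun k => - z k) w = - boundary z w.
Proof. by case: w => v /=; rewrite sumrN. Qed.

(** Transports are thus the nonnegative chains with prescribed boundary, and
    differences of transports are circulations. *)
Definition margin (w : V1 + V2) : int :=
  match w with inl _ => (#|V2|)%:Z | inr _ => - (#|V1|)%:Z end.

Lemma transportP m d :
  transport m d <-> forall w, boundary (fun k => (d k)%:Z) w = margin w * m%:Z.
Proof.
have sumZ (P : pred 'I_N) :
    \sum_(k < N | P k) (d k)%:Z = (\sum_(k < N | P k) d k)%N%:Z.
  by rewrite (big_morph Posz PoszD (erefl _)).
split=> [[dr dc] [i|j] /=|dw]; first by rewrite sumZ dr PoszM.
  by rewrite sumZ dc PoszM mulNr.
split=> v; first by have /= := dw (inl v); rewrite sumZ -PoszM => -[].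
by have /= := dw (inr v); rewrite sumZ mulNr => /oppr_inj; rewrite -PoszM => -[].
Qed.

Lemma transport_inj m m' d : (0 < #|V2|)%N -> V1 ->
  transport m d -> transport m' d -> m = m'.
Proof.
move=> V2_gt0 i [dr _] [dr' _]; move: (dr i); rewrite dr' => /eqP.
by rewrite eqn_pmul2l // => /eqP.
Qed.

Lemma transportD m m' d d' :
  transport m d -> transport m' d' -> transport (m + m') (d + d')%MM.
Proof.
by move=> [dr dc] [dr' dc']; split=> v; rewrite mulnDr -?(dr v) -?(dc v)
  -?(dr' v) -?(dc' v) -big_split; apply: eq_bigr => k _; rewrite mnmDE.
Qed.

Lemma transport0 : transport 0 0%MM.
Proof. by split=> v; rewrite muln0 big1 // => k _; rewrite mnm0E. Qed.

Lemma transportMn m d k : transport m d -> transport (k * m) (d *+ k)%MM.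
Proof.
move=> dm; elim: k => [|k IH]; first by rewrite mulm0n; apply: transport0.
by rewrite mulmS mulSn; apply: transportD.
Qed.

Lemma transport_rows m d (P : pred V1) : transport m d ->
  (\sum_(k < N | P (row k)) d k = #|P| * (#|V2| * m))%N.
Proof.
move=> [dr _]; rewrite (partition_big row P) // -sum_nat_const.
apply: eq_bigr => i Pi; rewrite -(dr i); apply: eq_bigl => k.
by case: eqP => [->|]; rewrite ?andbT ?andbF.
Qed.

Lemma transport_cols m d (P : pred V2) : transport m d ->
  (\sum_(k < N | P (col k)) d k = #|P| * (#|V1| * m))%N.
Proof.
move=> [_ dc]; rewrite (partition_big col P) // -sum_nat_const.
apply: eq_bigr => j Pj; rewrite -(dc j); apply: eq_bigl => k.
by case: eqP => [->|]; rewrite ?andbT ?andbF.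
Qed.

(** A circulation supported on the support of [d] can be subtracted from a
    multiple of [d] until some entry vanishes, so a transport of minimal support
    is acyclic. *)
Lemma acyclic_transport m d : (0 < m)%N -> transport m d ->
  exists m0 c, [/\ (0 < m0)%N, transport m0 c, acyclic c
    & forall k, d k = 0%N -> c k = 0%N].
Proof.
have [s] := ubnP #|[pred k | d k != 0%N]|.
elim: s d m => // s IH d m; rewrite ltnS => ds m_gt0 dm.
have [dac|] := pselect (acyclic d); first by exists m, d.
move=> /existsNP[z /not_implyP[zd /not_implyP[bz /existsNP[k0 zk0]]]].
wlog z_gt0 : z zd bz zk0 / 0 < z k0.
  move=> H; have [zk|zk|zk] := ltgtP 0 (z k0); [exact: (H z)| |by case: zk0].
  apply: (H (fun k => - z k)) => [k /zd ->|w||]; rewrite ?oppr0 ?oppr_gt0 //.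
    by rewrite boundaryN bz oppr0.
  by apply/eqP; rewrite oppr_eq0; apply/eqP.
(* The edge [e] is the first whose entry vanishes as multiples of [z] are subtracted. *)
pose ratio k : rat := (z k)%:~R / (d k)%:R.
have [e z_e emax] := @Order.TotalTheory.arg_maxP _ _ _ k0 (fun k => 0 < z k) ratio z_gt0.
have d_gt0 k : 0 < z k -> (0 < d k)%N.
  by move=> zk; rewrite lt0n; apply: contraTneq zk => /zd ->.
have ge0 k : 0 <= z e * (d k)%:Z - (d e)%:Z * z k.
  rewrite subr_ge0; have [zk|zk] := ltP 0 (z k); last first.
    by apply: (@le_trans _ _ 0); [rewrite mulr_ge0_le0 | rewrite mulr_ge0 // ltW].
  have := emax k zk; rewrite /ratio /= ler_pdivrMr ?ltr0n ?d_gt0 //.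
  rewrite mulrAC ler_pdivlMr ?ltr0n ?d_gt0 //.
  by rewrite (pmulrn 1 (d e)) (pmulrn 1 (d k)) -!intrM ler_int mulrC.
pose d' := [multinom absz (z e * (d k)%:Z - (d e)%:Z * z k)%R | k < N].
have d'E k : (d' k)%:Z = z e * (d k)%:Z - (d e)%:Z * z k.
  by rewrite mnmE gez0_abs.
have d'm : transport (`|z e| * m) d'.
  apply/transportP => w.
  have -> : (fun k => (d' k)%:Z) = (fun k => z e * (d k)%:Z + - ((d e)%:Z * z k)).
    by apply/funext => k; rewrite d'E.
  rewrite boundaryD boundaryN !boundaryZ bz mulr0 subr0.
  by rewrite (iffLR (transportP m d)) // PoszM gtz0_abs // mulrCA.
have d'd k : d k = 0%N -> d' k = 0%N.
  by move=> dk; apply/eqP; rewrite -eqz_nat d'E dk (zd k) // !mulr0 subrr.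
have m'_gt0 : (0 < `|z e| * m)%N by rewrite muln_gt0 absz_gt0 gt_eqF.
have d's : (#|[pred k | d' k != 0%N]| < s)%N.
  apply: leq_trans ds; apply: proper_card; apply/properP; split.
    by apply/fintype.subsetP => k; rewrite !inE; apply: contra_neq => /d'd.
  exists e; first by rewrite inE -lt0n d_gt0.
  by rewrite inE negbK -eqz_nat d'E mulrC subrr.
have [m0 [c [m0_gt0 cm cac cd]]] := IH d' _ d's m'_gt0 d'm.
by exists m0, c; split=> // k /d'd /cd.
Qed.

(** The homological form of being joined by a path in the support of [c]: adding
    chains replaces concatenating paths. *)
Definition linked c (u v : V1 + V2) : Prop :=
  exists2 z, forall k, c k = 0%N -> z k = 0
    & forall w, boundary z w = (w == u)%:R - (w == v)%:R.

Lemma linked_refl c u : linked c u u.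
Proof.
exists (fun=> 0) => // w; rewrite subrr.
by case: w => v /=; rewrite big1 // oppr0.
Qed.

Lemma linked_sym c u v : linked c u v -> linked c v u.
Proof.
move=> [z zc zb]; exists (fun k => - z k) => [k /zc ->|w]; first by rewrite oppr0.
by rewrite boundaryN zb opprB.
Qed.

Lemma linked_trans c u v w : linked c u v -> linked c v w -> linked c u w.
Proof.
move=> [z zc zb] [z' zc' zb']; exists (fun k => z k + z' k) => [k ck|x].
  by rewrite zc // zc' // addr0.
by rewrite boundaryD zb zb' addrA subrK.
Qed.

Lemma boundary_edge o w :
  boundary (fun k => (k == o)%:R) w = (w == inl (row o))%:R - (w == inr (col o))%:R.
Proof.
have sumE (P : pred 'I_N) : \sum_(k < N | P k) (k == o)%:R = (P o)%:R :> int.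
  have [Po|nPo] := boolP (P o).
    rewrite (bigD1 o) //= eqxx big1 ?addr0 // => k /andP[_ /negbTE -> //].
  by rewrite big1 // => k Pk; case: eqP => // ko; rewrite -ko Pk in nPo.
case: w => v /=; rewrite sumE eq_sym ?subr0 ?sub0r //.
Qed.

Lemma linked_edge c o : c o != 0%N -> linked c (inl (row o)) (inr (col o)).
Proof.
move=> co; exists (fun k => (k == o)%:R) => [k ck|w]; last exact: boundary_edge.
by case: eqP => // ko; rewrite -ko ck in co.
Qed.

Hypothesis V2_gt0 : (0 < #|V2|)%N.
Hypothesis coV : coprime #|V1| #|V2|.

(** A union [C] of connected components, with [a] rows and [b] columns, satisfies
    [a * #|V2| = b * #|V1|], because it carries the same total from either side;
    coprimality leaves only the whole graph. *)
Lemma transport_connected m c u v : (0 < m)%N -> transport m c -> linked c u v.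
Proof.
move=> m_gt0 cm; pose C w := `[< linked c u w >].
have Ck k : c k != 0%N -> C (inl (row k)) = C (inr (col k)).
  move=> /linked_edge ck; apply/asboolP/asboolP => uk.
    exact: linked_trans uk ck.
  by apply: linked_trans uk _; apply: linked_sym.
pose a := #|[pred i : V1 | C (inl i)]|; pose b := #|[pred j : V2 | C (inr j)]|.
have ab : (a * #|V2| = b * #|V1|)%N.
  apply/eqP; rewrite -(eqn_pmul2r m_gt0) -!mulnA.
  rewrite -(transport_rows _ cm) -(transport_cols _ cm); apply/eqP.
  rewrite big_mkcond [RHS]big_mkcond; apply: eq_bigr => k _ /=.
  by have [->|/Ck ->] := eqVneq (c k) 0%N; rewrite ?if_same.
have b_dvd : (#|V2| %| b)%N.
  by rewrite -(Gauss_dvdl _ (_ : coprime _ #|V1|)) 1?coprime_sym // -ab dvdn_mull.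
have Cu : C u by apply/asboolP; apply: linked_refl.
have b_gt0 : (0 < b)%N.
  rewrite lt0n; apply/eqP => b0; move/eqP: (ab); rewrite b0 mul0n muln_eq0.
  rewrite (gtn_eqF V2_gt0) orbF => /eqP a0.
  case: (u) Cu => [i|j] Cu.
    by have := card0_eq a0 i; rewrite inE Cu.
  by have := card0_eq b0 j; rewrite inE Cu.
have bE : b = #|V2| by apply/eqP; rewrite eqn_leq max_card dvdn_leq.
have aE : a = #|V1|.
  by apply/eqP; rewrite -(eqn_pmul2r V2_gt0) ab bE mulnC.
case: v => [i|j].
  have /card0_eq/(_ i) : #|[predC [pred i | C (inl i)]]| = 0%N.
    by apply/eqP; rewrite -(eqn_add2l a) cardC aE addn0.
  by rewrite !inE => /negbFE/asboolP.
have /card0_eq/(_ j) : #|[predC [pred j | C (inr j)]]| = 0%N.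
  by apply/eqP; rewrite -(eqn_add2l b) cardC bE addn0.
by rewrite !inE => /negbFE/asboolP.
Qed.

(** Unimodularity: the support of [c] is a spanning tree, which every other edge
    [o] closes up to a single cycle, giving the direction of [D o - k c]. *)
Lemma fundamental_transport m c : (0 < m)%N -> transport m c ->
  exists k (D : 'I_N -> 'X_{1..N}), forall o, c o = 0%N ->
    transport (k * m) (D o) /\ forall x, c x = 0%N -> D o x = (x == o).
Proof.
move=> m_gt0 cm.
have /choice[z zP] : forall o, exists z : 'I_N -> int,
    (forall k, c k = 0%N -> z k = 0) /\ forall w, boundary z w =
      (w == inl (row o))%:R - (w == inr (col o))%:R.
  by move=> o; have [z] := transport_connected (inl (row o)) (inr (col o)) m_gt0 cm;
    exists z.
(* Adding [k c] makes up for any negative entry of a fundamental cycle. *)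
pose k := (\sum_(o < N) \sum_(x < N) `|z o x|)%N.
have zk o x : z o x <= k%:Z.
  apply: le_trans (lez_abs _) _; rewrite lez_nat /k (bigD1 o) //= (bigD1 x) //=.
  by rewrite -addnA leq_addr.
pose F o x : int := (x == o)%:R - z o x + k%:Z * (c x)%:Z.
have F_ge0 o x : 0 <= F o x.
  rewrite /F -addrA addr_ge0 ?ler0n //; have [cx|cx] := eqVneq (c x) 0%N.
    by rewrite (zP o).1 // cx mulr0 addr0 oppr0.
  rewrite addrC subr_ge0; apply: le_trans (zk o x) _.
  by rewrite -PoszM lez_nat leq_pmulr // lt0n.
exists k, (fun o => [multinom `|F o x|%N | x < N]) => o co; split=> [|x cx].
  apply/transportP => w.
  have -> : (fun x => ([multinom `|F o x|%N | x < N] x)%:Z) =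
      (fun x => (x == o)%:R + - z o x + k%:Z * (c x)%:Z).
    by apply/funext => x; rewrite mnmE gez0_abs.
  rewrite !boundaryD boundaryN boundaryZ boundary_edge (zP o).2 subrr add0r.
  by rewrite (iffLR (transportP m c)) // PoszM mulrCA.
by rewrite mnmE /F (zP o).1 // cx mulr0 addr0 subr0; case: (x == o).
Qed.

Lemma acyclic_transport_inj m c d d' : acyclic c ->
  transport m d -> transport m d' ->
  (forall k, c k = 0%N -> d k = d' k) -> d = d'.
Proof.
move=> cac dm dm' dd'; apply/mnmP => k; apply/eqP.
rewrite -eqz_nat -subr_eq0; apply/eqP.
apply: (cac (fun k => (d k)%:Z + - (d' k)%:Z)) => [x cx|w].
  by rewrite dd' // subrr.
by rewrite boundaryD boundaryN !(iffLR (transportP m _)) // subrr.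
Qed.

End Transportation.

(** * Proj of the algebra of transports *)

Section ToricProj.
Variables (K : numFieldType) (D : Type) (S : gradedFunAlg K D).
Variables (N : nat) (V1 V2 : finType) (row : 'I_N -> V1) (col : 'I_N -> V2).
Variable pt : ('I_N -> K) -> D.
Notation transport := (transport row col).

Hypotheses (V1_gt0 : (0 < #|V1|)%N) (V2_gt0 : (0 < #|V2|)%N).
Hypothesis coV : coprime #|V1| #|V2|.
(** Together the next three hypotheses say that restriction along [pt] identifies
    [S] with the graded semigroup algebra of the transports. *)
Hypothesis S_monomial : forall m d, transport m d ->
  exists2 F, S m F & forall y, F (pt y) = 'X_[d].@[y].
Hypothesis S_span : forall m F, S m F ->
  exists2 p : {mpoly K[N]}, forall y, F (pt y) = p.@[y]
    & forall d, d \in msupp p -> transport m d.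
Hypothesis S_inj : forall m F G, S m F -> S m G ->
  (forall y, F (pt y) = G (pt y)) -> F = G.

Definition monomial_section m d (F : D -> K) : Prop :=
  [/\ transport m d, S m F & forall y, F (pt y) = 'X_[d].@[y]].

Lemma monomial_sectionM m m' d d' F F' :
  monomial_section m d F -> monomial_section m' d' F' ->
  monomial_section (m + m') (d + d')%MM (F * F').
Proof.
move=> [dm SF FE] [dm' SF' FE']; split; first exact: transportD.
  exact: gpart_mul.
by move=> y; rewrite mpolyXD mevalM -FE -FE'.
Qed.

Lemma monomial_section1 : monomial_section 0 0%MM 1.
Proof.
split; [exact: transport0 | exact: gpart_cst | move=> y].
by rewrite mpolyX0 meval1.
Qed.

Lemma monomial_sectionX m d F k :
  monomial_section m d F -> monomial_section (k * m) (d *+ k)%MM (F ^+ k).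
Proof.
move=> Fd; elim: k => [|k IH]; first by rewrite mulm0n; apply: monomial_section1.
by rewrite mulmS mulSn exprS; apply: monomial_sectionM.
Qed.

Lemma monomial_section_prod (I : Type) (s : seq I) (m : I -> nat) d F :
  (forall i, monomial_section (m i) (d i) (F i)) ->
  monomial_section (\sum_(i <- s) m i) (\sum_(i <- s) d i)%MM (\prod_(i <- s) F i).
Proof.
move=> Fd; elim: s => [|i s IH]; first by rewrite !big_nil; apply: monomial_section1.
by rewrite !big_cons; apply: monomial_sectionM.
Qed.

Lemma monomial_section_uniq m m' d F F' :
  monomial_section m d F -> monomial_section m' d F' -> F = F'.
Proof.
move=> [dm SF FE] [dm' SF' FE']; have /card_gt0P[i _] := V1_gt0.
have mm' := transport_inj V2_gt0 i dm dm'; rewrite -mm' in SF'.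
by apply: (S_inj SF SF') => y; rewrite FE FE'.
Qed.

Lemma monomial_section_ex m d : transport m d -> exists F, monomial_section m d F.
Proof. by move=> dm; have [F SF FE] := S_monomial dm; exists F. Qed.

Lemma gpart_scale m c F : S m F -> S m (cst c * F).
Proof. by move=> SF; rewrite -[m]add0n; apply: gpart_mul => //; apply: gpart_cst. Qed.

Lemma gpart_sum m (I : eqType) (s : seq I) (F : I -> D -> K) :
  S m 0 -> (forall i, i \in s -> S m (F i)) -> S m (\sum_(i <- s) F i).
Proof.
move=> S0 SF; rewrite big_seq; elim/big_rec: _ => // i G /SF SFi SG.
by rewrite -[G]opprK; apply: gpart_sub => //; rewrite -sub0r; apply: gpart_sub.
Qed.

Lemma section_expansion m F : S m F ->
  exists (p : {mpoly K[N]}) (X : 'X_{1..N} -> D -> K),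
    (forall d, d \in msupp p -> monomial_section m d (X d)) /\
    F = \sum_(d <- msupp p) cst p@_d * X d.
Proof.
move=> SF; have [p FE pm] := S_span SF.
have /choice[X XP] : forall d, exists G, d \in msupp p -> monomial_section m d G.
  move=> d; have [/pm/monomial_section_ex[G Gd]|_] := boolP (d \in msupp p).
    by exists G.
  by exists 0.
exists p, X; split=> //; apply: (S_inj SF) => [|y].
  apply: gpart_sum => [|d /XP[_ Sd _]]; last exact: gpart_scale.
  by rewrite -[0](subrr F); apply: gpart_sub.
rewrite FE mevalE fct_sumE; apply: eq_big_seq => d /XP[_ _ XE].
by rewrite -mevalX -XE.
Qed.

Section Chart.
Variables (m : nat) (c : 'X_{1..N}) (f : D -> K).
Hypotheses (m_gt0 : (0 < m)%N) (fc : monomial_section m c f).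
Hypothesis c_acyclic : acyclic row col c.

(** On the chart of a spanning tree, the fundamental cycles of the edges off the
    tree are free coordinates: they generate because circulations are determined
    by their values off the tree, and take arbitrary values at the points whose
    tree coordinates are all [1]. *)
Lemma tree_chart_smooth (fP : S m f) : smooth_algebra (homog_loc_cst fP).
Proof.
have cm : transport m c by case: fc.
have [k [Dm DP]] := fundamental_transport V2_gt0 coV m_gt0 cm.
pose O := {o : 'I_N | c o == 0%N}; pose n := #|{: O}|.
pose edge (i : 'I_n) : 'I_N := val (enum_val i : O).
have cedge i : c (edge i) = 0%N by apply/eqP/(valP (enum_val i : O)).
have /choice[Y YP] : forall i, exists G, monomial_section (k * m) (Dm (edge i)) G.
  by move=> i; apply: monomial_section_ex; apply: (DP _ (cedge i)).1.
have hP i : (fun x : nonvanishing f => Y i (val x) / f (val x) ^+ k)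
    \in homog_loc_pred fP.
  by apply/asboolP; exists k, (Y i); have [_] := YP i.
pose h i : homog_loc fP := HomogLoc (hP i).
have [phi [phiC phiX]] := mpoly_eval_pz (homog_loc_cst fP) h.
have phiE p x : homog_loc_val (phi p) x = p.@[fun i => homog_loc_val (h i) x].
  pose ev (a : homog_loc fP) : K := homog_loc_val a x.
  have evz : zmod_morphism ev by [].
  have evm : monoid_morphism ev by [].
  pose Ev : {rmorphism homog_loc fP -> K} :=
    HB.pack ev (GRing.isZmodMorphism.Build _ _ ev evz)
               (GRing.isMonoidMorphism.Build _ _ ev evm).
  have := @rmorph_mpoly_ext K n K (Ev \o phi) (meval (fun i => homog_loc_val (h i) x)).
  apply=> [a|i] /=; first by rewrite phiC mevalC.
  by rewrite phiX mevalXU.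
apply: (smooth_polynomial phiC) => [p q pq|a].
  apply/eqP; rewrite -subr_eq0; apply/eqP; apply: mpoly_eval_eq0 => z.
  (* The point with coordinates [z] off the tree and [1] on the tree. *)
  pose y o := if [pick i | edge i == o] is Some i then z i else 1.
  have edge_inj : injective edge by move=> i j /val_inj/enum_val_inj.
  have yedge i : y (edge i) = z i.
    rewrite /y; case: pickP => [j /eqP/edge_inj -> //|/(_ i)].
    by rewrite eqxx.
  have ytree o : c o != 0%N -> y o = 1.
    rewrite /y; case: pickP => // i /eqP <-; by rewrite cedge.
  have fy : f (pt y) = 1.
    have [_ _ ->] := fc; rewrite mevalX big1 // => o _.
    have [->|/ytree ->] := eqVneq (c o) 0%N; by rewrite ?expr0 ?expr1n.
  have fy0 : f (pt y) != 0 by rewrite fy oner_eq0.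
  have Yy i : Y i (pt y) = z i.
    have [_ _ ->] := YP i; rewrite mevalX (bigD1 (edge i)) //=.
    rewrite (DP _ (cedge i)).2 ?cedge // eqxx expr1 yedge big1 ?mulr1 // => o oi.
    have [co|/ytree ->] := eqVneq (c o) 0%N; last by rewrite expr1n.
    by rewrite (DP _ (cedge i)).2 // (negbTE oi) expr0.
  have := congr1 (fun a => homog_loc_val a (exist _ (pt y) fy0)) pq.
  rewrite !phiE mevalB => E; apply/eqP; rewrite subr_eq0; apply/eqP.
  have zE : z =1 (fun i => homog_loc_val (h i) (exist _ (pt y) fy0)).
    by move=> i /=; rewrite fy expr1n divr1 Yy.
  by rewrite !(meval_eq _ zE).
have /asboolP[l [s [Ss sE]]] := homog_loc_valP a.
have [q [X [XP qE]]] := section_expansion Ss.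
pose e (d : 'X_{1..N}) := [multinom d (edge i) | i < n].
exists (\sum_(d <- msupp q) q@_d *: 'X_[e d]).
apply: val_inj; apply/funext => x; apply: etrans (esym (sE x)).
rewrite [LHS]phiE qE.
rewrite raddf_sum fct_sumE mulr_suml; apply: eq_big_seq => d dq /=.
rewrite mevalZ mevalX -mulrA; congr (_ * _).
have fx := valP x; rewrite /= in fx.
pose t := (\sum_i d (edge i))%N.
(* Both sides are monomial sections, whose exponents agree off the tree. *)
have /(congr1 (fun g => g (val x))) : X d * f ^+ (t * k) = (\prod_i Y i ^+ d (edge i)) * f ^+ l.
  have L := monomial_sectionM (XP d dq) (monomial_sectionX (t * k) fc).
  have Rr := monomial_sectionM (monomial_section_prod (index_enum _)
    (fun i => monomial_sectionX (d (edge i)) (YP i))) (monomial_sectionX l fc).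
  apply: (monomial_section_uniq L).
  have [Lt _ _] := L; have [Rt _ _] := Rr.
  suff -> : (d + c *+ (t * k) = \sum_i Dm (edge i) *+ d (edge i) + c *+ l)%MM by exact: Rr.
  apply: (acyclic_transport_inj c_acyclic Lt).
    rewrite (_ : (l * m + t * k * m)%N = (\sum_i d (edge i) * (k * m) + l * m)%N) //.
    by rewrite -big_distrl /= -/t -mulnA addnC.
  move=> o co; rewrite !mnmDE !mulmnE co !mul0n !addn0 mnm_sumE.
  pose i := enum_rank (exist _ o (introT eqP co) : O).
  have ei : edge i = o by rewrite /edge /i enum_rankK.
  rewrite (bigD1 i) //= mulmnE ei (DP _ co).2 // eqxx mul1n big1 ?addn0 // => j ji.
  rewrite mulmnE (DP _ (cedge j)).2 // -ei; case: eqP => // /val_inj/enum_val_inj ij.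
  by rewrite ij eqxx in ji.
have -> (g g' : D -> K) y : (g * g') y = g y * g' y by [].
have -> (g g' : D -> K) y : (g * g') y = g y * g' y by [].
rewrite !exprfctE => E.
apply: (mulIf (expf_neq0 l fx)); rewrite divfK ?expf_neq0 //.
apply: (mulIf (expf_neq0 (t * k) fx)); rewrite E mulrAC; congr (_ * _).
rewrite fct_prodE /t big_distrl /= -prodrXr -big_split /=; apply: eq_bigr => i _.
rewrite mnmE exprfctE expr_div_n mulnC exprM divfK // expf_neq0 // expf_neq0 //.
Qed.

End Chart.

(** A homogeneous prime omits some monomial section, hence by primality one whose
    exponent is acyclic and supported on the support of the former. *)
Theorem toric_Proj_smooth : Proj_smooth S.
Proof.
move=> p [pS padd pmul pprime [m [F [m_gt0 SF pF]]]].
have [q [X [XP qE]]] := section_expansion SF.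
have [d [dq pd]] : exists d, d \in msupp q /\ ~ p m (X d).
  apply: contra_notP pF => /forallNP all_p.
  have pX d : d \in msupp q -> p m (X d).
    by move=> dq; apply: contrapT => pd; case: (all_p d).
  rewrite qE big_seq; elim/big_rec: _ => [|d G dq pG]; first exact: (padd m).1.
  apply: (padd m).2 => //; rewrite -[m]add0n; apply: pmul (pX d dq).
  exact: gpart_cst.
have Xd := XP d dq; have [dm _ _] := Xd.
have [m0 [c [m0_gt0 cm cac cd]]] := acyclic_transport m_gt0 dm.
have [f fc] := monomial_section_ex cm; have [_ Sf _] := fc.
exists m0, f, Sf; split=> // [pf|]; last exact: (tree_chart_smooth m0_gt0 fc cac Sf).
(* The first summand gives [c <= k d], the second [m0 <= k m]. *)
pose k := (\sum_(x < N) c x + m0)%N.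
have kd : (c <= d *+ k)%MM.
  apply/mnm_lepP => x; rewrite mulmnE; have [dx|dx] := eqVneq (d x) 0%N.
    by rewrite cd.
  apply: leq_trans (_ : k <= _)%N; last by rewrite leq_pmull // lt0n.
  by rewrite /k (bigD1 x) //= -addnA leq_addr.
have rest : transport (k * m - m0) (d *+ k - c)%MM.
  have m0k : (m0 <= k * m)%N.
    by apply: leq_trans (leq_pmulr _ m_gt0); rewrite leq_addl.
  have [cr cc] := cm; have [dr dc] := transportMn k dm.
  by split=> v; rewrite mulnBr -?(cr v) -?(dr v) -?(cc v) -?(dc v);
    (rewrite -sumnB => [|x _]; last exact: (mnm_lepP kd)); apply: eq_bigr => x _;
    rewrite mnmBE.
have [G Gr] := monomial_section_ex rest; have [_ SG _] := Gr.
have GfE : G * f = X d ^+ k.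
  have Gf := monomial_sectionM Gr fc; rewrite submK // in Gf.
  exact: monomial_section_uniq Gf (monomial_sectionX k Xd).
have [_ SX _] := Xd.
suff pXk j : ~ p (j * m)%N (X d ^+ j).
  apply: (pXk k); rewrite -GfE (_ : (k * m = (k * m - m0) + m0)%N); first exact: pmul.
  by rewrite subnK //; apply: leq_trans (leq_pmulr _ m_gt0); rewrite leq_addl.
elim: j => [|j IH].
  rewrite mul0n expr0 => p1; apply: pF; rewrite -[m]addn0 -[F]mulr1.
  exact: pmul.
rewrite mulSn exprS => /pprime; case=> //; exact: gpart_exp.
Qed.

End ToricProj.

(** * Colouring intervals *)

Lemma prod_count (R : comPzRingType) (I : finType) (g : I -> R) (s : seq I) :
  \prod_(x <- s) g x = \prod_x g x ^+ count_mem x s.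
Proof.
elim: s => [|x s IH]; first by rewrite big_nil big1.
rewrite big_cons IH (bigD1 x) //= [RHS](bigD1 x) //= eqxx exprD expr1 mulrA.
by congr (_ * _); apply: eq_bigr => y yx; rewrite eq_sym (negbTE yx).
Qed.

Lemma pairwiseP_mem (T : eqType) (e : rel T) (s : seq T) x y :
  pairwise e s -> x \in s -> y \in s -> [\/ x = y, e x y | e y x].
Proof.
elim: s => // z s IH /= /andP[/allP zs es]; rewrite !inE.
case/predU1P=> [->|xs] /predU1P[->|ys]; [by constructor 1 | | |exact: IH].
  by constructor 2; apply: zs.
by constructor 3; apply: zs.
Qed.

(** Interval graphs are perfect: when the intervals [[lo x, hi x]] are treated
    from left to right, those already coloured which meet the next interval all
    contain its left end, so that some colour is free. *)
Lemma interval_coloring (T : eqType) (lo hi : T -> nat) (M : nat) (s : seq T) :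
  (forall x, x \in s -> lo x <= hi x)%N ->
  sorted (fun x y => lo y <= lo x)%N s ->
  (forall x, x \in s -> count (fun y => lo y <= lo x <= hi y) s <= M)%N ->
  exists F : 'I_M -> seq T,
    (forall c, pairwise (fun x y => hi y < lo x)%N (F c)) /\
    (forall a, \sum_c count a (F c) = count a s)%N.
Proof.
elim: s => [|x s IH] lohi srt cnt.
  by exists (fun=> [::]); split=> // a; rewrite big1.
have [|||F [Fpair Fcount]] := IH.
- by move=> y ys; apply: lohi; rewrite inE ys orbT.
- exact: path_sorted srt.
- move=> y ys; apply: leq_trans (cnt y _); last by rewrite inE ys orbT.
  by rewrite /= leq_addl.
have lo_max y : y \in s -> (lo y <= lo x)%N.
  have tr : transitive (fun x y => lo y <= lo x)%N.
    by move=> b a c ba cb; apply: leq_trans cb ba.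
  by move: y; apply/allP; apply: order_path_min srt.
have Fs c y : y \in F c -> y \in s.
  rewrite -!has_pred1 !has_count => yc; rewrite -Fcount (bigD1 c) //=.
  by rewrite addn_gt0 yc.
have [c0 free] : exists c, all (fun y => hi y < lo x)%N (F c).
  apply/existsP; apply: contraT; rewrite negb_exists => /forallP full.
  have := cnt x (mem_head _ _); rewrite /= leqnn lohi ?mem_head //= -Fcount.
  rewrite add1n ltnNge => /negP[]; rewrite -[leqLHS]card_ord -sum1_card.
  apply: leq_sum => c _; have := full c; rewrite -has_predC -has_count.
  case/hasP=> y yc /= hiy; apply/hasP; exists y => //=.
  by rewrite lo_max ?(Fs c) // leqNgt.
exists (fun c => if c == c0 then x :: F c else F c); split=> [c|a].
  by case: eqP => [->|_] //=; rewrite free Fpair.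
rewrite (bigD1 c0) //= eqxx /= -Fcount [in RHS](bigD1 c0) //= addnA; congr addn.
by apply: eq_bigr => c /negbTE ->.
Qed.

Lemma perm_ge_id (r : nat) (s : 'S_r) : (forall j : 'I_r, j <= s j)%N -> s = 1%g.
Proof.
move=> sge; have sumE : (\sum_j (s j : nat) = \sum_(j < r) (j : nat))%N.
  by rewrite [RHS](reindex_inj (@perm_inj _ s)).
apply/permP => j; rewrite perm1; apply/val_inj/eqP => /=.
have := leqif_sum (I := 'I_r) (P := predT) (fun j _ => leqif_eq (sge j)).
by rewrite sumE => -[_]; rewrite eqxx => /esym/forallP/(_ j); rewrite eq_sym.
Qed.

(** * Echelon matrices and their maximal minors *)

Section Cell.
Variables (r n : nat) (w : 'I_r -> 'I_n).
Hypothesis w_inc : forall i j : 'I_r, (i < j)%N -> (w i < w j)%N.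

Lemma w_inj : injective w.
Proof.
move=> i j wij; apply/val_inj; case: (ltngtP i j) => // /w_inc; by rewrite wij ltnn.
Qed.

Lemma w_ltE i j : (w i < w j)%N = (i < j)%N.
Proof.
case: (ltngtP i j) => [/w_inc->//|/w_inc ji|/val_inj ->]; last by rewrite ltnn.
by rewrite ltnNge ltnW.
Qed.

Definition nonpivot := {i : 'I_n | i \notin codom w}.

Lemma big_split_pivots (R : Type) (idx : R) (op : Monoid.com_law idx) (F : 'I_n -> R) :
  \big[op/idx]_u F u =
    op (\big[op/idx]_(i : nonpivot) F (val i)) (\big[op/idx]_j F (w j)).
Proof.
rewrite (bigID (mem (codom w))) /= Monoid.mulmC; congr (op _ _).
  rewrite (reindex_omap (val : nonpivot -> 'I_n) insub) => [|i ni]; last by rewrite insubT.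
  by apply: eq_bigl => -[i ni]; rewrite /= insubT /= eqxx andbT ni.
rewrite -[RHS](big_image _ _ _ _ F) big_uniq //.
by apply/(@injectiveP _ _ w)/w_inj.
Qed.

Lemma card_nonpivot : #|{: nonpivot}| = (n - r)%N.
Proof.
have := big_split_pivots addn (fun=> 1%N).
by rewrite /= !sum1_card !card_ord => nE; rewrite -[LHS](addnK r) -nE.
Qed.

(** The coordinates of the open cell: in the column echelon form with pivot rows
    [w], column [j] is free in the nonpivot rows above [w j]. *)
Definition entry := {x : nonpivot * 'I_r | (val x.1 < w x.2)%N}.
Definition N_cell := #|{: entry}|.
Implicit Types k : 'I_N_cell.
Definition erow k : nonpivot := (val (enum_val k : entry)).1.
Definition ecol k : 'I_r := (val (enum_val k : entry)).2.

Lemma erow_lt k : (val (erow k) < w (ecol k))%N.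
Proof. exact: valP (enum_val k : entry). Qed.

Lemma entry_inj k k' : erow k = erow k' -> ecol k = ecol k' -> k = k'.
Proof.
rewrite /erow /ecol => er ec; apply/enum_val_inj/val_inj.
by apply/eqP; rewrite -pair_eqE /= er ec !eqxx.
Qed.

Lemma entry_ex (i : nonpivot) j : (val i < w j)%N ->
  exists2 k, erow k = i & ecol k = j.
Proof.
move=> ij; pose x : entry := exist _ (i, j) ij.
by exists (enum_rank x); rewrite /erow /ecol enum_rankK.
Qed.

Definition echelon (R : comNzRingType) (y : 'I_N_cell -> R) : 'M[R]_(n, r) :=
  \matrix_(i, j) if i \in codom w then (w j == i)%:R
                 else \sum_(k | (val (erow k) == i) && (ecol k == j)) y k.

Section Echelon.
Variables (R : comNzRingType) (y : 'I_N_cell -> R).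

Lemma echelon_pivot j j' : echelon y (w j) j' = (j == j')%:R.
Proof. by rewrite mxE codom_f (inj_eq w_inj) eq_sym. Qed.

Lemma echelon_entry k : echelon y (val (erow k)) (ecol k) = y k.
Proof.
rewrite mxE (negbTE (valP (erow k))) (big_pred1 k) // => k' /=.
apply/andP/eqP => [[/eqP/val_inj er /eqP ec]|->]; last by rewrite !eqxx.
exact: entry_inj.
Qed.

Lemma echelon_eq0 (i : 'I_n) j : (w j < i)%N -> echelon y i j = 0.
Proof.
move=> ji; rewrite mxE; case: ifP => _.
  by case: eqP => // wji; rewrite wji ltnn in ji.
rewrite big1 // => k /andP[/eqP ki /eqP kj]; move: (erow_lt k).
by rewrite ki kj ltnNge ltnW.
Qed.

(** The entry [k] is seen as the interval [[erow k, w (ecol k)]]; a sequence that is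
    pairwise related lists disjoint intervals from right to left. *)
Definition chain : rel 'I_N_cell := fun k k' => (w (ecol k') < val (erow k))%N.

(** Row sets of maximal minors; those of chains are the minors that are monomials. *)
Definition exchange (t : seq 'I_N_cell) (j : 'I_r) : 'I_n :=
  if [pick k in t | ecol k == j] is Some k then val (erow k) else w j.

(** A permutation contributing to this determinant fixes the columns that keep
    their pivot and, the intervals [[erow k, w (ecol k)]] being disjoint, cannot
    decrease the other ones. *)
Lemma det_exchange t : pairwise chain t ->
  \det (\matrix_(i, j) echelon y (exchange t i) j) = \prod_(k <- t) y k.
Proof.
move=> t_chain.
have t_uniq : uniq t.
  by apply: pairwise_uniq t_chain => k; rewrite /chain ltnNge ltnW ?erow_lt.
have col_inj k k' : k \in t -> k' \in t -> ecol k = ecol k' -> k = k'.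
  move=> kt k't kk'; case: (pairwiseP_mem t_chain kt k't) => //; rewrite /chain.
    by rewrite -kk' ltnNge ltnW ?erow_lt.
  by rewrite kk' ltnNge ltnW ?erow_lt.
have exP j : (exists k, [/\ k \in t, ecol k = j & exchange t j = val (erow k)]) \/
    (forall k, k \in t -> ecol k != j) /\ exchange t j = w j.
  rewrite /exchange; case: pickP => [k /andP[kt /eqP kj]|no]; [left | right].
    by exists k.
  by split=> // k kt; have := no k; rewrite kt => /negbT.
rewrite /determinant (bigD1 1%g) //= [X in _ + X]big1 ?addr0; last first.
  move=> s; apply: contraNeq => nz.
  have term_nz j : echelon y (exchange t j) (s j) != 0.
    by apply: contraNneq nz => j0; rewrite (bigD1 j) //= mxE j0 mul0r mulr0.
  apply/eqP/perm_ge_id => j.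
  have [[k [kt kj ex]]|[_ ex]] := exP j; last first.
    have := term_nz j; rewrite ex echelon_pivot.
    by case: (j =P s j) => [<-|]; rewrite ?eqxx.
  rewrite leqNgt; apply/negP => sj_lt.
  have row_le : (val (erow k) <= w (s j))%N.
    by rewrite leqNgt; apply: contraNN (term_nz j) => /echelon_eq0; rewrite ex => ->.
  have [[k' [k't k'j _]]|[_ ex']] := exP (s j).
    case: (pairwiseP_mem t_chain kt k't) => [kk'||]; rewrite ?/chain ?k'j ?kj.
    - by move: sj_lt; rewrite -k'j -kk' kj ltnn.
    - by rewrite ltnNge row_le.
    - move=> lt; have := ltn_trans lt (erow_lt k'); rewrite k'j w_ltE => lt'.
      by have := ltn_trans lt' sj_lt; rewrite ltnn.
  have := term_nz (s j); rewrite ex' echelon_pivot.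
  case: (s j =P s (s j)) => [/perm_inj sj|]; last by rewrite eqxx.
  by rewrite -sj ltnn in sj_lt.
rewrite odd_perm1 expr0 mul1r (partition_big ecol predT) //=.
apply: eq_bigr => j _; rewrite perm1 mxE.
have [[k [kt kj ->]]|[no ->]] := exP j; last first.
  by rewrite echelon_pivot eqxx big_seq_cond big1 // => k /andP[kt]; rewrite (negbTE (no k kt)).
rewrite -kj echelon_entry big_mkcond (bigD1_seq k) //= eqxx big_seq_cond big1 ?mulr1 //.
move=> k' /andP[k't k'k]; case: eqP => // /(col_inj _ _ k't kt) kk'.
by rewrite kk' eqxx in k'k.
Qed.
End Echelon.

End Cell.

(** * Pluecker coordinates *)

Section Pluecker.
Variables (K : fieldType) (r n : nat).
Implicit Types (u v : inc_tuple r n) (A : 'M[K]_(n, r)) (x : extpow K r n).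

Definition pluecker A : extpow K r n :=
  [ffun u : inc_tuple r n => \det (\matrix_(i < r, j < r) A (val u i) j)].

Lemma inc_tuple_lt u (i j : 'I_r) : (i < j)%N -> (val u i < val u j)%N.
Proof. by move=> ij; have /forallP/(_ i)/forallP/(_ j)/implyP := valP u; apply. Qed.

Lemma inc_tuple_sort (rho : 'I_r -> 'I_n) : injective rho ->
  exists (u : inc_tuple r n) (s : 'S_r), forall i, rho i = val u (s i).
Proof.
move=> rho_inj; pose leo := [rel a b : 'I_n | (a <= b)%N].
pose rt := [tuple rho i | i < r]; pose t := sort_tuple leo rt.
have leo_total : total leo by move=> a b; apply: leq_total.
have leo_trans : transitive leo by move=> b a c; apply: leq_trans.
have t_pair : pairwise leo t.
  by rewrite -(sorted_pairwise leo_trans); apply: sort_sorted.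
have t_uniq : uniq t.
  by rewrite sort_uniq map_inj_uniq // -?enumT ?enum_uniq.
have t_inc : [forall i : 'I_r, forall j : 'I_r,
    (i < j)%N ==> ([ffun k => tnth t k] i < [ffun k => tnth t k] j)%N].
  apply/'forall_'forall_implyP => i j ij; rewrite !ffunE ltn_neqAle.
  have ne : tnth t i != tnth t j.
    by rewrite (inj_eq (elimT (tuple_uniqP t) t_uniq)) neq_ltn ij.
  apply/andP; split=> //; rewrite !(tnth_nth (rho i)).
  by apply: (pairwiseP (rho i) t_pair); rewrite ?inE ?size_tuple.
have /tuple_permP[s sE] : perm_eq rt t by rewrite perm_sym perm_sort.
pose u : inc_tuple r n := exist _ [ffun k => tnth t k] t_inc.
exists u, s => i; rewrite /= ffunE.
have := congr1 (fun q : seq 'I_n => nth (rho i) q i) sE.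
by rewrite -!tnth_nth !tnth_mktuple.
Qed.

Lemma ext_eval_scale d (P : {mpoly K[#|{: inc_tuple r n}|]}) x x' l :
  P \is d.-homog -> (forall u, x' u = l * x u) ->
  ext_eval P x' = l ^+ d * ext_eval P x.
Proof.
move=> /dhomogP Pd xx'; rewrite /ext_eval !mevalE mulr_sumr.
apply: eq_big_seq => m /Pd md; rewrite mulrCA; congr (_ * _).
rewrite -[d]md [X in l ^+ X]mdegE -prodrXr -big_split /=; apply: eq_bigr => i _.
by rewrite xx' exprMn.
Qed.

Lemma minor_mulmx (rho : 'I_r -> 'I_n) A (C : 'M[K]_r) :
  \det (\matrix_(i < r, j < r) (A *m C) (rho i) j) =
    \det C * \det (\matrix_(i < r, j < r) A (rho i) j).
Proof.
rewrite mulrC -det_mulmx; congr (\det _); apply/matrixP => i j.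
by rewrite !mxE; apply: eq_bigr => k _; rewrite mxE.
Qed.

Lemma minor_diag_mulmx (rho : 'I_r -> 'I_n) (t : 'M[K]_n) A : is_diag_mx t ->
  \det (\matrix_(i < r, j < r) (t *m A) (rho i) j) =
    (\prod_i t (rho i) (rho i)) * \det (\matrix_(i < r, j < r) A (rho i) j).
Proof.
move=> t_diag; pose d := \row_i t (rho i) (rho i).
rewrite -(_ : \det (diag_mx d) = \prod_i t (rho i) (rho i)); last first.
  by rewrite det_diag; apply: eq_bigr => i _; rewrite mxE.
rewrite -det_mulmx mul_diag_mx; congr (\det _); apply/matrixP => i j.
rewrite !mxE (bigD1 (rho i)) //= big1 ?addr0 // => k ki.
by rewrite (is_diag_mxP t_diag) ?mul0r // eq_sym.
Qed.

Lemma pluecker_mulmx A (C : 'M[K]_r) u :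
  pluecker (A *m C) u = \det C * pluecker A u.
Proof. by rewrite !ffunE minor_mulmx. Qed.

Lemma ext_act_ebasis (g : 'M[K]_n) w :
  ext_act g (ebasis K w) = pluecker (\matrix_(i, j) g i (val w j)).
Proof.
apply/ffunP => u; rewrite !ffunE (bigD1 w) //= big1 => [|v vw].
  rewrite addr0 ffunE eqxx mulr1; congr (\det _).
  by apply/matrixP => i j; rewrite !mxE.
by rewrite ffunE (negbTE vw) mulr0.
Qed.

(** A nonzero term of a minor of a diagonal matrix matches the rows with the
    columns by an increasing permutation, hence by the identity. *)
Lemma ext_act_diag (t : 'M[K]_n) x : is_diag_mx t ->
  ext_act t x = [ffun u : inc_tuple r n => (\prod_i t (val u i) (val u i)) * x u].
Proof.
move=> /is_diag_mxP t_diag; apply/ffunP => u; rewrite !ffunE (bigD1 u) //=.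
rewrite [X in _ + X]big1 ?addr0 => [|v vu]; last first.
  rewrite /determinant big1 ?mul0r // => s _; apply: contraNeq vu => nz.
  have us i : val u i = val v (s i).
    apply/val_inj/eqP; apply: contraNT nz => ne.
    by rewrite (bigD1 i) //= mxE t_diag ?mul0r ?mulr0.
  suff s1 : s = 1%g.
    by apply/eqP/val_inj/ffunP => i; rewrite us s1 perm1.
  have s_inc (i j : 'I_r) : (i < j)%N -> (s i < s j)%N.
    move=> /(inc_tuple_lt u); rewrite !us => lt.
    case: (ltngtP (s i) (s j)) => // [/(inc_tuple_lt v)|/val_inj] ji.
      by have := ltn_trans lt ji; rewrite ltnn.
    by rewrite ji ltnn in lt.
  apply: perm_ge_id => j; move: {2}(j : nat) (erefl (j : nat)) => a.
  elim: a j => [|a IH] j ja; first by rewrite ja.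
  have ar : (a < r)%N by rewrite ltnW // -ja.
  by rewrite ja; apply: leq_ltn_trans (IH (Ordinal ar) erefl) (s_inc _ _ _); rewrite ja.
congr (_ * _); pose d := \row_i t (val u i) (val u i).
rewrite (_ : \matrix_(_, _) _ = diag_mx d); last first.
  apply/matrixP => i j; rewrite !mxE; case: eqP => [->//|ij].
  rewrite t_diag //; apply/eqP => /val_inj uij; case: ij; apply: val_inj.
  by case: (ltngtP i j) => // /(inc_tuple_lt u); rewrite uij ltnn.
by rewrite det_diag; apply: eq_bigr => i _; rewrite mxE.
Qed.

Lemma ext_act_pluecker (t : 'M[K]_n) A : is_diag_mx t ->
  ext_act t (pluecker A) = pluecker (t *m A).
Proof.
move=> t_diag; rewrite ext_act_diag //; apply/ffunP => u.
by rewrite !ffunE minor_diag_mulmx.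
Qed.

(** Up to sign, a minor with rows in any order is a Pluecker coordinate, and it
    vanishes if a row is repeated. *)
Lemma minor_form (rho : 'I_r -> 'I_n) :
  exists2 P : {mpoly K[#|{: inc_tuple r n}|]}, P \is 1.-homog
    & forall A, ext_eval P (pluecker A) = \det (\matrix_(i < r, j < r) A (rho i) j).
Proof.
have [/injectiveP/inc_tuple_sort[u [s us]]|/injectivePn[i [j ij rij]]] :=
    boolP (injectiveb rho); last first.
  exists 0 => [|A]; first exact: dhomog0.
  rewrite /ext_eval meval0 (determinant_alternate ij) // => k.
  by rewrite !mxE rij.
exists ((-1) ^+ s *: 'X_(enum_rank u)) => [|A].
  by apply: dhomogZ; rewrite dhomogX; apply/eqP/mdeg1.
rewrite /ext_eval mevalZ mevalXU enum_rankK ffunE -det_perm -det_mulmx -row_permE.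
by congr (\det _); apply/matrixP => i j; rewrite !mxE us.
Qed.
End Pluecker.

(** * The open cell of a Schubert variety *)

Section SchubertCell.
Variables (K : numClosedFieldType) (r n : nat) (w : inc_tuple r n).

Notation N := (N_cell (val w)).
Notation X := (@schubert_cone K r n w).
Notation piv := (fun_of_fin (val w)).
Implicit Types (y : 'I_N -> K).

Let piv_inc := @inc_tuple_lt r n w.
Let piv_inj : injective piv := w_inj piv_inc.

Notation cell y := (echelon (w := piv) y).

Lemma grass_cell y (C : 'M[K]_r) : C \in unitmx ->
  grass_cone (pluecker (cell y *m C)).
Proof.
move=> Cu; exists (cell y *m C); split=> //; apply/eqP/row_fullP.
exists (invmx C *m \matrix_(j, i) (i == piv j)%:R).
rewrite -mulmxA (mulmxA _ (cell y)) (_ : _ *m cell y = 1%:M) ?mul1mx ?mulVmx //.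
apply/matrixP => j j'; rewrite !mxE (bigD1 (piv j)) //= mxE eqxx mul1r.
rewrite (echelon_pivot piv_inc) big1 ?addr0 // => i /negbTE ij.
by rewrite mxE ij mul0r.
Qed.

(** An echelon matrix consists of the pivot columns of a unipotent upper triangular
    matrix, the other columns being those of the identity. *)
Lemma cell_in_orbit y : exists2 b : 'M[K]_n, borel b &
  ext_act b (ebasis K w) = pluecker (cell y).
Proof.
pose b : 'M[K]_n := \matrix_(i, j)
  if [pick j' | piv j' == j] is Some j' then cell y i j' else (i == j)%:R.
have bw i j : b i (piv j) = cell y i j.
  by rewrite mxE; case: pickP => [j' /eqP/piv_inj ->|/(_ j)] //; rewrite eqxx.
have bn i j : (forall j', piv j' != j) -> b i j = (i == j)%:R.
  by move=> nj; rewrite mxE; case: pickP => // j'; rewrite (negbTE (nj j')).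
have caseb j : (exists j', piv j' = j) \/ (forall j', piv j' != j).
  have [/existsP[j' /eqP]|] := boolP [exists j', piv j' == j]; first by left; exists j'.
  by rewrite negb_exists => /forallP; right.
have b_up (i j : 'I_n) : (j < i)%N -> b i j = 0.
  move=> ji; have [[j' jE]|/bn ->] := caseb j.
    by rewrite -jE bw echelon_eq0 // jE.
  by case: eqP => // ij; rewrite ij ltnn in ji.
exists b.
  split=> //; rewrite -det_tr det_trig; last first.
    by apply/is_trig_mxP => i j ij; rewrite mxE b_up.
  apply: big1 => i _; rewrite mxE; have [[j' <-]|/bn ->] := caseb i.
    by rewrite bw (echelon_pivot piv_inc) eqxx.
  by rewrite eqxx.
rewrite ext_act_ebasis; congr pluecker; apply/matrixP => i j.
by rewrite mxE bw.
Qed.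

Lemma schubert_cell y (C : 'M[K]_r) : C \in unitmx -> X (pluecker (cell y *m C)).
Proof.
move=> Cu; split=> [|d P Pd P0]; first exact: grass_cell.
rewrite (ext_eval_scale Pd (pluecker_mulmx _ _)).
by have [b bb <-] := cell_in_orbit y; rewrite P0 // mulr0.
Qed.

Lemma schubert_cell1 y : X (pluecker (cell y)).
Proof. by rewrite -[cell y]mulmx1; apply: schubert_cell; rewrite unitmx1. Qed.

Definition cell_point y : {x | X x} := exist _ _ (schubert_cell1 y).

(** Column reduction: the columns [w] of an upper triangular matrix are the
    echelon matrix of a point of the cell times an upper triangular one. *)
Lemma orbit_in_cell (b : 'M[K]_n) : borel b -> exists y l,
  forall u, ext_act b (ebasis K w) u = l * pluecker (cell y) u.
Proof.
move=> [b_up b1].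
have diag_nz i : b i i != 0.
  have detb : \det b = \prod_i b i i.
    rewrite -det_tr det_trig; first by apply: eq_bigr => j _; rewrite mxE.
    by apply/is_trig_mxP => j k jk; rewrite mxE b_up.
  have : \prod_i b i i != 0 by rewrite -detb b1 oner_eq0.
  by apply: contraNneq => bi; rewrite (bigD1 i) //= bi mul0r.
pose B := \matrix_(i, j) b i (piv j); pose U := \matrix_(i, j) B (piv i) j.
have U_up (i j : 'I_r) : (j < i)%N -> U i j = 0.
  by move=> ji; rewrite !mxE b_up // piv_inc.
have Uu : U \in unitmx.
  rewrite unitmxE unitfE -det_tr det_trig; last first.
    by apply/is_trig_mxP => i j ij; rewrite mxE U_up.
  by rewrite prodf_seq_neq0; apply/allP => i _ /=; rewrite !mxE diag_nz.
pose A := B *m invmx U.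
have AU : A *m U = B by rewrite mulmxKV.
have A_piv i j : A (piv i) j = (i == j)%:R.
  have := congr1 (fun M : 'M[K]_r => M i j) (mulmxV Uu); rewrite [RHS]mxE => <-.
  by rewrite !mxE; apply: eq_bigr => k _; rewrite !mxE.
have A_up (i : 'I_n) (j : 'I_r) : (piv j < i)%N -> A i j = 0.
  move: {2}(j : nat) (erefl (j : nat)) => a.
  elim/ltn_ind: a j => a IH j ja ji.
  have : B i j = 0 by rewrite mxE b_up.
  rewrite -AU mxE (bigD1 j) //= big1 ?addr0 => [/eqP|k kj].
    have Ujj : U j j = b (piv j) (piv j) by rewrite !mxE.
    by rewrite mulf_eq0 Ujj (negbTE (diag_nz _)) orbF => /eqP.
  case: (ltngtP k j) => [lt|gt|/val_inj kE]; last by rewrite kE eqxx in kj.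
    by rewrite (IH k) ?mul0r -?ja // (ltn_trans _ ji) // piv_inc.
  by rewrite U_up ?mulr0.
pose y (k : 'I_N) := A (val (erow k)) (ecol k).
have AE : A = cell y.
  apply/matrixP => i j; have [/codomP[i' ->]|ni] := boolP (i \in codom piv).
    by rewrite A_piv (echelon_pivot piv_inc).
  have [ij|ji] := ltnP i (piv j).
    have [k ki kj] := entry_ex (i := exist _ i ni) ij.
    have iE : i = val (erow k) by rewrite ki.
    by rewrite iE -kj echelon_entry.
  have {}ji : (piv j < i)%N.
    rewrite ltn_neqAle ji andbT; apply: contraNneq ni => /val_inj <-.
    exact: codom_f.
  by rewrite A_up // echelon_eq0.
exists y, (\det U) => u.
by rewrite ext_act_ebasis -pluecker_mulmx -AE AU.
Qed.

(** The cell is dense: clearing denominators in local expressions of [F] and [G]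
    gives a form that vanishes on the orbit, hence on its closure. *)
Lemma section_cell_inj k F G : section_space (X := X) k F -> section_space (X := X) k G ->
  (forall y, F (cell_point y) = G (cell_point y)) -> F = G.
Proof.
move=> sF sG FG; apply/funext => x.
have [d [A [B [hA hB Bx FE]]]] := sF x.
have [d' [A' [B' [hA' hB' Bx' GE]]]] := sG x.
rewrite FE // GE //; apply/eqP; rewrite eqr_div // -subr_eq0.
(* The factor [B * B'] makes [P] vanish where the local expressions do not apply. *)
pose P := (A * B' - A' * B) * (B * B').
have evM P1 P2 z : ext_eval (P1 * P2) z = ext_eval P1 z * ext_eval P2 z :> K.
  by rewrite /ext_eval mevalM.
have evP z : ext_eval P z = (ext_eval A z * ext_eval B' z -
    ext_eval A' z * ext_eval B z) * (ext_eval B z * ext_eval B' z) :> K.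
  by rewrite /P evM /ext_eval mevalB !mevalM.
have hP : P \is (d + k + d' + (d + d')).-homog.
  apply: dhomogM; last exact: dhomogM.
  apply: rpredB; first exact: dhomogM.
  by rewrite -addnA [(k + d')%N]addnC addnC dhomogM.
have : ext_eval P (sval x) = 0.
  have [_ Xx] := proj2_sig x; apply: (Xx _ _ hP) => b /orbit_in_cell[y [l yl]].
  rewrite (ext_eval_scale hP yl) (_ : ext_eval P _ = 0) ?mulr0 //.
  rewrite evP; set z := pluecker _.
  have [->|Bz] := eqVneq (ext_eval B z) 0; first by rewrite mul0r mulr0.
  have [->|Bz'] := eqVneq (ext_eval B' z) 0; first by rewrite !mulr0.
  have := FG y; rewrite FE // GE // => /eqP; rewrite eqr_div // => /eqP ->.
  by rewrite subrr mul0r.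
by rewrite evP => /eqP; rewrite !mulf_eq0 (negbTE Bx) (negbTE Bx') !orbF.
Qed.

Lemma section_scale k F (x x' : {x | X x}) l : section_space (X := X) k F -> l != 0 ->
  (forall u, sval x' u = l * sval x u) -> F x' = l ^+ k * F x.
Proof.
move=> sF l0 xx'; have [d [A [B [hA hB Bx FE]]]] := sF x.
have Bx' : ext_eval B (sval x') != 0.
  by rewrite (ext_eval_scale hB xx') mulf_neq0 // expf_neq0.
rewrite !FE // (ext_eval_scale hB xx') (ext_eval_scale hA xx') exprD.
have ld : l ^+ d != 0 by rewrite expf_neq0.
by field; rewrite ld Bx.
Qed.

Lemma map_echelon (R R' : comNzRingType) (f : {rmorphism R -> R'}) (z : 'I_N -> R) :
  map_mx f (cell z) = cell (f \o z).
Proof.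
apply/matrixP => i j; rewrite !mxE; case: ifP => _; first by rewrite rmorph_nat.
by rewrite rmorph_sum.
Qed.

(** Evaluate [P] at the minors of the generic echelon matrix. *)
Lemma ext_eval_cell (P : {mpoly K[#|{: inc_tuple r n}|]}) :
  exists Q : {mpoly K[N]}, forall y, ext_eval P (pluecker (cell y)) = Q.@[y].
Proof.
pose E := cell (fun k : 'I_N => 'X_k : {mpoly K[N]}).
pose q := [tuple \det (\matrix_(i < r, j < r) E (val (enum_val u : inc_tuple r n) i) j)
   | u < #|{: inc_tuple r n}|].
exists (P \mPo q) => y; rewrite comp_mpoly_meval /ext_eval; apply: meval_eq => u.
have EyE : map_mx (meval y) E = cell y.
  by rewrite map_echelon; congr echelon; apply/funext => k /=; rewrite mevalXU.
rewrite tnth_mktuple ffunE -EyE -det_map_mx; congr (\det _).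
by apply/matrixP => i j; rewrite !mxE.
Qed.

Lemma section_cell_polynomial k F : section_space (X := X) k F ->
  exists p : {mpoly K[N]}, forall y, F (cell_point y) = p.@[y].
Proof.
move=> sF; apply: regular_polynomial => a.
have [d [A [B [_ _ Bx FE]]]] := sF (cell_point a).
have [A' A'E] := ext_eval_cell A; have [B' B'E] := ext_eval_cell B.
exists A', B'; rewrite -B'E; split=> // y; rewrite -B'E -A'E => By.
exact: FE.
Qed.

End SchubertCell.

(** * Extending invariant monomials over the Schubert variety *)

Section SchubertSections.
Variables (K : numClosedFieldType) (r n : nat) (w : inc_tuple r n).
Hypothesis r_lt_n : (r < n)%N.
Hypothesis w_le : forall j, (r * val w j <= j.+1 * n)%N.

Notation N := (N_cell (val w)).
Notation X := (@schubert_cone K r n w).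
Notation piv := (fun_of_fin (val w)).
Notation cell y := (echelon (w := piv) y).
Notation erow := (@erow r n piv).
Notation ecol := (@ecol r n piv).
Notation transport := (transport erow ecol).
Implicit Types (y : 'I_N -> K) (t : 'M[K]_n) (d : 'X_{1..N}).

Let piv_inc := @inc_tuple_lt r n w.

(** The bound on [w] enters here.  With [J] the number of pivots above the row [i],
    the edges through [i] carry what the rows up to [i] supply and the first [J]
    columns do not consume. *)
Lemma overlap_le m d (i : 'I_n) : transport m d -> i \notin codom piv ->
  (\sum_(k | val (erow k) <= i <= piv (ecol k)) d k <= n * m)%N.
Proof.
move=> dm ni; pose a := #|[pred i' : nonpivot piv | (val i' <= i)%N]|.
pose J := #|[pred j : 'I_r | (piv j < i)%N]|.
have aJ : (a + J = i.+1)%N.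
  rewrite -[RHS]card_ord -[RHS]sum1_card.
  rewrite (big_ord_widen n (fun=> 1%N) (ltn_ord i)) big_mkcond /=.
  rewrite (big_split_pivots piv_inc addn) /= -!big_mkcond !sum1_card; congr addn.
  apply: eq_card => j; rewrite inE -[RHS]/(piv j < i.+1)%N ltnS [RHS]leq_eqVlt.
  by case: eqP => // /val_inj ij; rewrite -ij codom_f in ni.
have rows := transport_rows (fun i' : nonpivot piv => val i' <= i)%N dm.
have cols := transport_cols (fun j : 'I_r => piv j < i)%N dm.
rewrite -/a card_ord in rows; rewrite -/J card_nonpivot // in cols.
have split_rows : (\sum_(k | val (erow k) <= i) d k =
   \sum_(k | val (erow k) <= i <= piv (ecol k)) d k + \sum_(k | piv (ecol k) < i) d k)%N.
  rewrite (bigID (fun k => i <= piv (ecol k))%N) /=; congr addn; apply: eq_bigl => k.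
  rewrite -ltnNge; case: ltnP; rewrite ?andbF // andbT => ki.
  by rewrite ltnW // (ltn_trans (erow_lt k)).
have iJ : (r * i.+1 <= J.+1 * n)%N.
  have [Jr|rJ] := ltnP J r; last first.
    by rewrite leq_mul // ltnW.
  apply: leq_trans (w_le (Ordinal Jr)); rewrite leq_mul2l; apply/orP; right.
  rewrite ltn_neqAle; apply/andP; split.
    by apply: contraNneq ni => /val_inj ->; apply: codom_f.
  rewrite leqNgt; apply/negP => wJ.
  have : (#|[pred j : 'I_r | (j <= J)%N]| <= J)%N.
    apply: subset_leq_card; apply/fintype.subsetP => j; rewrite !inE => jJ.
    apply: leq_ltn_trans wJ; case: (ltngtP j J) jJ => // [jJ _|jE _].
      by apply: ltnW; apply: piv_inc.
    by rewrite (_ : j = Ordinal Jr) //; apply: val_inj.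
  suff -> : #|[pred j : 'I_r | (j <= J)%N]| = J.+1 by rewrite ltnn.
  by rewrite -sum1_card -[RHS]card_ord -[RHS]sum1_card (big_ord_widen r (fun=> 1%N) Jr).
rewrite -(leq_add2r (\sum_(k < N | piv (ecol k) < i) d k)%N) -split_rows rows cols.
have key : (a * r <= n + J * (n - r))%N.
  rewrite -(leq_add2r (J * r)) -addnA -mulnDl aJ -mulnDr subnK ?(ltnW r_lt_n) //.
  by rewrite mulnC -mulSn.
by rewrite !mulnA -mulnDl leq_mul2r key orbT.
Qed.

(** Colour the intervals of the edges counted by [d], with their multiplicities. *)
Lemma transport_chains m d : transport m d ->
  exists F : 'I_(n * m) -> seq 'I_N,
    (forall c, pairwise (chain (w := piv)) (F c)) /\
    (forall g : 'I_N -> K, \prod_c \prod_(k <- F c) g k = \prod_k g k ^+ d k).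
Proof.
move=> dm; pose le_lo := [rel k k' | (val (erow k') <= val (erow k))%N].
pose s0 := flatten [seq nseq (d k) k | k <- enum 'I_N].
pose s := sort le_lo s0.
have counts (a : pred 'I_N) : count a s = (\sum_(k | a k) d k)%N.
  rewrite (seq.permP (permEl (perm_sort le_lo s0))) count_flatten sumnE !big_map -enumT big_enum /=.
  rewrite [RHS]big_mkcond; apply: eq_bigr => k _; rewrite count_nseq.
  by case: (a k); rewrite ?mul1n.
have le_total : total le_lo by move=> k k'; apply: leq_total.
have [|||F [Fchain Fcount]] := @interval_coloring _
    (fun k => val (erow k) : nat) (fun k => piv (ecol k) : nat) (n * m) s.
- by move=> k _; rewrite ltnW // erow_lt.
- exact: sort_sorted.
- by move=> k _; rewrite counts; apply: overlap_le => //; apply: valP (erow k).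
exists F; split=> // g.
transitivity (\prod_c \prod_k g k ^+ count_mem k (F c)).
  by apply: eq_bigr => c _; apply: prod_count.
rewrite exchange_big /=; apply: eq_bigr => k _.
by rewrite prodrXr Fcount counts (big_pred1 k).
Qed.

Lemma det_diag_mx t : is_diag_mx t -> \det t = \prod_i t i i.
Proof.
move=> t_diag; rewrite det_trig //; apply/is_trig_mxP => i j ij.
by rewrite (is_diag_mxP t_diag) // neq_ltn ij.
Qed.

Lemma torus_neq0 t i : torus t -> t i i != 0.
Proof.
move=> [t_diag t1]; have : \det t != 0 by rewrite t1 oner_eq0.
by rewrite det_diag_mx //; apply: contraNneq => ti; rewrite (bigD1 i) //= ti mul0r.
Qed.

(** The torus acts on the cell by rescaling the coordinate [k]. *)
Definition cell_weight t k : K :=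
  t (val (erow k)) (val (erow k)) / t (piv (ecol k)) (piv (ecol k)).

Definition pivot_mx t : 'M[K]_r := diag_mx (\row_j t (piv j) (piv j)).

Lemma det_pivot_mx t : \det (pivot_mx t) = \prod_j t (piv j) (piv j).
Proof. by rewrite det_diag; apply: eq_bigr => j _; rewrite mxE. Qed.

Lemma torus_cell t y : torus t ->
  t *m cell y = cell (fun k => cell_weight t k * y k) *m pivot_mx t.
Proof.
move=> tT; have [t_diag _] := tT; apply/matrixP => i j.
rewrite mul_mx_diag [LHS]mxE (bigD1 i) //= big1 ?addr0 => [|k ki]; last first.
  by rewrite (is_diag_mxP t_diag) ?mul0r // eq_sym.
rewrite !mxE; case: ifP => _.
  by case: eqP => [->|_]; rewrite ?mulr0 ?mul0r // mulr1 mul1r.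
rewrite mulr_sumr mulr_suml; apply: eq_bigr => k /andP[/eqP <- /eqP <-].
by rewrite /cell_weight mulrAC divfK // torus_neq0.
Qed.

(** Compare the minors of both sides of [torus_cell] at the point with all
    coordinates equal to [1]. *)
Lemma exchange_weight t (s : seq 'I_N) : torus t -> pairwise (chain (w := piv)) s ->
  \prod_j t (exchange (w := piv) s j) (exchange (w := piv) s j) =
    \det (pivot_mx t) * \prod_(k <- s) cell_weight t k.
Proof.
move=> tT s_chain; have [t_diag _] := tT.
have := minor_diag_mulmx (exchange (w := piv) s) (cell (fun=> 1)) t_diag.
rewrite torus_cell // minor_mulmx !(det_exchange piv_inc) //.
rewrite big1_eq mulr1 => <-; congr (_ * _).
by apply: eq_bigr => k _; rewrite mulr1.
Qed.

(** The total weight is a power of [\det t]: every row index, pivot or not, occurs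
    [r * m] times in it. *)
Lemma transport_weight t m d : torus t -> transport m d ->
  \det (pivot_mx t) ^+ (n * m) * \prod_k cell_weight t k ^+ d k = 1.
Proof.
move=> tT [dr dc]; have [t_diag t1] := tT.
rewrite card_ord in dr; rewrite card_nonpivot // in dc.
pose T i := t i i.
have rowE : \prod_k T (val (erow k)) ^+ d k = (\prod_(i : nonpivot piv) T (val i)) ^+ (r * m).
  rewrite (partition_big erow predT) //= -prodrXl; apply: eq_bigr => i _.
  by rewrite -(dr i) -prodrXr; apply: eq_bigr => k /eqP ->.
have colE : \prod_k T (piv (ecol k)) ^+ d k = \det (pivot_mx t) ^+ ((n - r) * m).
  rewrite det_pivot_mx (partition_big ecol predT) //= -prodrXl; apply: eq_bigr => j _.
  by rewrite -(dc j) -prodrXr; apply: eq_bigr => k /eqP ->.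
have Q0 : \det (pivot_mx t) != 0.
  by rewrite det_pivot_mx prodf_seq_neq0; apply/allP => j _; apply: torus_neq0.
under eq_bigr do rewrite expr_div_n.
rewrite prodf_div rowE colE.
have -> : \det (pivot_mx t) ^+ (n * m) =
    \det (pivot_mx t) ^+ ((n - r) * m) * \det (pivot_mx t) ^+ (r * m).
  by rewrite -exprD -mulnDl subnK // ltnW.
rewrite [X in X * (_ / _)]mulrC -mulrA [X in _ * X]mulrC divfK ?expf_neq0 //.
rewrite -exprMn det_pivot_mx mulrC.
have := big_split_pivots piv_inc *%R T.
by rewrite /= -det_diag_mx // t1 => <-; rewrite expr1n.
Qed.

Lemma cone_torus_eval t x rho : torus t -> forall P : {mpoly K[#|{: inc_tuple r n}|]},
  (forall A, ext_eval P (pluecker A) = \det (\matrix_(i < r, j < r) A (rho i) j)) ->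
  grass_cone x ->
  ext_eval P (ext_act t x) = (\prod_j t (rho j) (rho j)) * ext_eval P x.
Proof.
move=> [t_diag _] P PE [A [_ ->]]; rewrite -/(pluecker A) ext_act_pluecker // !PE.
exact: minor_diag_mulmx.
Qed.

(** The edges counted by [d] form [n * m] chains, and the product over a chain is a
    Pluecker coordinate up to sign. *)
Lemma cell_monomial_extends m d : transport m d ->
  exists2 F : {x | X x} -> K, inv_sections (X := X) m F
    & forall y, F (cell_point y) = 'X_[d].@[y].
Proof.
move=> dm; have [F [Fchain Fprod]] := transport_chains dm.
have /choice[P PP] : forall c, exists P : {mpoly K[#|{: inc_tuple r n}|]},
    P \is 1.-homog /\ forall A, ext_eval P (pluecker A) =
      \det (\matrix_(i < r, j < r) A (exchange (w := piv) (F c) i) j).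
  by move=> c; have [P] := minor_form K (exchange (w := piv) (F c)); exists P.
have prod_homog (s : seq 'I_(n * m)) : \prod_(c <- s) P c \is (size s).-homog.
  elim: s => [|c s IH]; first by rewrite big_nil dhomog1.
  by rewrite big_cons -[size _]/(1 + size s)%N dhomogM //; apply: (PP c).1.
have evE x : ext_eval (\prod_c P c) x = \prod_c ext_eval (P c) x.
  by rewrite /ext_eval rmorph_prod.
exists (fun x => ext_eval (\prod_c P c) (sval x)); last first.
  move=> y; rewrite evE mevalX -Fprod; apply: eq_bigr => c _.
  by rewrite (PP c).2 det_exchange.
split=> [x|t tT x x' xx'].
  exists 0%N, (\prod_c P c), 1; have ev1 z : ext_eval 1 z = 1 :> K by rewrite /ext_eval meval1.
  split=> [|||z _]; rewrite ?ev1 ?oner_eq0 ?divr1 //; last exact: dhomog1.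
  have := prod_homog (index_enum _); congr (_ \is _.-homog).
  by rewrite add0n -sum1_size sum1_card card_ord.
have [gx _] := proj2_sig x.
rewrite xx' !evE.
under eq_bigr => c _ do rewrite (cone_torus_eval tT (PP c).2 gx) exchange_weight //.
rewrite big_split /= big_split /= prodr_const card_ord Fprod.
by rewrite transport_weight // mul1r.
Qed.

End SchubertSections.

(** * The quotient of a Schubert variety *)

Lemma msupp_weight (K : numFieldType) (N : nat) (p : {mpoly K[N]}) (a : K) (s : 'I_N -> K) :
  (forall y, p.@[y] = a * p.@[fun k => s k * y k]) ->
  forall d, d \in msupp p -> a * \prod_k s k ^+ d k = 1.
Proof.
move=> pE d dp; pose q := \sum_(e <- msupp p)
  (p@_e * (1 - a * \prod_k s k ^+ e k)) *: 'X_[e].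
have q0 : q = 0.
  apply: mpoly_eval_eq0 => y; rewrite raddf_sum /=.
  transitivity (p.@[y] - a * p.@[fun k => s k * y k]); last by rewrite -pE subrr.
  rewrite !mevalE mulr_sumr -sumrB; apply: eq_bigr => e _.
  have -> : \prod_k (s k * y k) ^+ e k = (\prod_k s k ^+ e k) * \prod_k y k ^+ e k.
    by rewrite -big_split; apply: eq_bigr => k _; rewrite exprMn.
  by rewrite mevalZ mevalX; ring.
have := congr1 (mcoeff d) q0; rewrite mcoeff0 raddf_sum /= (bigD1_seq d) ?msupp_uniq //=.
rewrite mcoeffZ mcoeffX eqxx mulr1 [X in _ + X]big1 => [|e /negbTE ed]; last first.
  by rewrite mcoeffZ mcoeffX ed mulr0.
rewrite addr0 => /eqP; rewrite mulf_eq0 mcoeff_eq0 dp /= subr_eq0 => /eqP; exact: esym.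
Qed.

Section SchubertQuotient.
Variables (K : numClosedFieldType) (r n : nat) (w : inc_tuple r n).
Hypotheses (r_gt0 : (0 < r)%N) (r_lt_n : (r < n)%N).

Notation N := (N_cell (val w)).
Notation X := (@schubert_cone K r n w).
Notation piv := (fun_of_fin (val w)).
Notation cell y := (echelon (w := piv) y).
Notation erow := (@erow r n piv).
Notation ecol := (@ecol r n piv).
Notation transport := (transport erow ecol).

Let piv_inc := @inc_tuple_lt r n w.
Let piv_inj : injective piv := w_inj piv_inc.

Lemma inv_section_weight m (F : {x | X x} -> K) (p : {mpoly K[N]}) (t : 'M[K]_n) :
  inv_sections (X := X) m F -> (forall y, F (cell_point y) = p.@[y]) -> torus t ->
  forall d, d \in msupp p ->
    \det (pivot_mx w t) ^+ (n * m) * \prod_k cell_weight t k ^+ d k = 1.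
Proof.
move=> [sF iF] FE tT; apply: msupp_weight => y; rewrite -!FE.
have [t_diag _] := tT.
have Q0 : \det (pivot_mx w t) != 0.
  by rewrite det_pivot_mx prodf_seq_neq0; apply/allP => j _; apply: torus_neq0.
have Xt : X (ext_act t (sval (cell_point (w := w) y))).
  rewrite /= ext_act_pluecker // torus_cell //; apply: schubert_cell.
  by rewrite unitmxE unitfE.
rewrite -(iF t tT (cell_point y) (exist _ _ Xt) erefl).
apply: section_scale sF Q0 _ => u.
by rewrite /= ext_act_pluecker // torus_cell // pluecker_mulmx.
Qed.

(** Up to a scalar matrix, one row is dilated and the others are fixed; invariance
    under such an element determines the row or column sum at [a]. *)
Definition dilation (a : 'I_n) : 'M[K]_n :=
  diag_mx (\row_i (2 ^+ (n * (i == a)) / 2)).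

Lemma dilationE a i : dilation a i i = 2 ^+ (n * (i == a)) / 2.
Proof. by rewrite !mxE eqxx mulr1n. Qed.

Lemma torus_dilation a : torus (dilation a).
Proof.
split; first exact: diag_mx_is_diag.
rewrite det_diag (bigD1 a) //= mxE eqxx muln1.
rewrite (eq_bigr (fun=> 2^-1)) => [|i /negbTE ia]; last by rewrite mxE ia muln0 mul1r.
rewrite prodr_const cardC1 card_ord -mulrA -exprS prednK; last first.
  exact: leq_ltn_trans r_lt_n.
by rewrite exprVn divff // expf_neq0 // pnatr_eq0.
Qed.

(** The dilations give the monomials occurring in an invariant section the row and
    column sums of a transport. *)
Lemma inv_section_transport m (F : {x | X x} -> K) (p : {mpoly K[N]}) :
  inv_sections (X := X) m F -> (forall y, F (cell_point y) = p.@[y]) ->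
  forall d, d \in msupp p -> transport m d.
Proof.
move=> iF FE d dp.
have n_gt0 : (0 < n)%N by apply: leq_ltn_trans r_lt_n.
have two0 : (2 : K) != 0 by rewrite pnatr_eq0.
have exp2_inj : injective (GRing.exp (2 : K)).
  by apply: ieexprIn; rewrite ?ltr0n // (eqr_nat K 2 1).
have weight a := inv_section_weight iF FE (torus_dilation a) dp.
(* For a nonpivot row all the pivots have weight [1 / 2]. *)
have row_eq (i : nonpivot piv) : (n * \sum_(k | erow k == i) d k = n * (r * m))%N.
  have npiv j : (piv j == val i) = false.
    by apply: contraNF (valP i) => /eqP <-; apply: codom_f.
  have := weight (val i).
  have -> : \det (pivot_mx w (dilation (val i))) = (2 ^+ r)^-1.
    rewrite det_pivot_mx (eq_bigr (fun=> 2^-1)) => [|j _].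
      by rewrite prodr_const card_ord exprVn.
    by rewrite dilationE npiv muln0 mul1r.
  rewrite (eq_bigr (fun k => 2 ^+ (n * (if erow k == i then d k else 0)))) => [|k _].
    rewrite prodrXr -big_distrr -big_mkcond /= exprVn -exprM.
    move/(canRL (mulVKf (expf_neq0 _ two0))); rewrite mulr1 => /exp2_inj ->.
    by rewrite mulnCA.
  rewrite /cell_weight !dilationE npiv muln0 mul1r invrK divfK // -exprM.
  by rewrite (inj_eq val_inj); case: eqP; rewrite ?muln1 ?muln0.
(* For the pivot row of column [j] that column is rescaled as well. *)
have col_eq j : (n * (r * m + \sum_(k | ecol k == j) d k) = n * (n * m))%N.
  have := weight (piv j).
  have -> : \det (pivot_mx w (dilation (piv j))) = 2 ^+ n / 2 ^+ r.
    rewrite det_pivot_mx (eq_bigr (fun j' => 2 ^+ (n * (j' == j)) / 2)) => [|j' _].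
      rewrite prodf_div prodr_const card_ord prodrXr (bigD1 j) //= eqxx muln1.
      by rewrite big1 ?addn0 // => j' /negbTE ->; rewrite muln0.
    by rewrite dilationE (inj_eq piv_inj).
  rewrite (eq_bigr (fun k => (2 ^+ (n * (if ecol k == j then d k else 0)))^-1)) => [|k _].
    rewrite prodfV prodrXr -big_distrr -big_mkcond /= expr_div_n -!exprM -mulrA -invfM.
    by rewrite -exprD => /divr1_eq/exp2_inj ->; rewrite mulnDr mulnCA.
  rewrite /cell_weight !dilationE (inj_eq piv_inj).
  have -> : (val (erow k) == piv j) = false.
    by apply: contraNF (valP (erow k)) => /eqP ->; apply: codom_f.
  rewrite muln0 expr0 -mulf_div divff ?invr_eq0 // mulr1 mul1r exprVn -exprM.
  by case: eqP; rewrite ?muln1 ?muln0.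
split=> [i|j].
  by apply/eqP; rewrite card_ord -(eqn_pmul2l n_gt0) row_eq.
apply/eqP; rewrite card_nonpivot // mulnBl; move/eqP: (col_eq j).
by rewrite eqn_pmul2l // => /eqP <-; rewrite addKn.
Qed.

(** As [r] and [n] are coprime, the bound says that [w] is at most [w_rn] in the
    Bruhat order. *)
Theorem schubert_quotient_smooth (w_le : forall j, (r * val w j <= j.+1 * n)%N) :
  coprime r n -> GIT_quotient_smooth X.
Proof.
move=> rn_coprime.
apply: (@toric_Proj_smooth _ _ _ N (nonpivot piv) 'I_r erow ecol (@cell_point K r n w)).
- by rewrite card_nonpivot // subn_gt0.
- by rewrite card_ord.
- rewrite card_nonpivot // card_ord coprime_sym.
  by rewrite /coprime -gcdnDr subnK // ltnW.
- exact: cell_monomial_extends.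
- move=> m F iF; have [sF _] := iF; have [p pE] := section_cell_polynomial sF.
  by exists p => //; apply: inv_section_transport iF pE.
- by move=> m F G [sF _] [sG _]; apply: section_cell_inj sF sG.
Qed.

End SchubertQuotient.

Theorem theorem3p1 (R : realType) (r n : nat) (r_gt0 : (0 < r)%N)
    (r_lt_n : (r < n)%N) (rn_coprime : coprime r n) :
  GIT_quotient_smooth (@schubert_cone R[i] r n (w_rn r_gt0 r_lt_n)).
Proof.
apply: schubert_quotient_smooth => // j; rewrite /= ffunE /= /w_min.
case: ex_minnP => a aP amin; rewrite mulnC.
have [->|a_gt0] := posnP a; first by rewrite mul0n.
by rewrite leqNgt; apply/negP => /ltnW/amin; rewrite leqNgt prednK ?leqnn.
Qed.
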